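(* Let $L$ be a self-adjoint positive definite operator in a Hilbert space $\mathcal{H}$, let $D=L^{1/2}$, let $\alpha>0$, $1\le q\le\infty$ and $a>1$. Then the norm of the Besov space $\mathbf{B}^{\alpha}_{2,q}(D)$ is equivalent to each of the following norms: $$\|f\|+\left(\int_{0}^{\infty}\left(s^{\alpha}\mathcal{E}(f,s)\right)^{q}\frac{ds}{s}\right)^{1/q},$$ $$\|f\|+\left(\sum_{k=0}^{\infty}\left(a^{k\alpha}\mathcal{E}(f,a^{k})\right)^{q}\right)^{1/q},$$ $$\|f\|+\left(\int_{0}^{\infty}\left(s^{\alpha}\mathcal{R}(f,s)\right)^{q}\frac{ds}{s}\right)^{1/q},$$ $$\|f\|+\left(\sum_{k=0}^{\infty}\left(a^{k\alpha}\mathcal{R}(f,a^{k})\right)^{q}\right)^{1/q}.$$ For $q=\infty$ these expressions are read, respectively, as $\|f\|+\sup_{s>0}s^{\alpha}\mathcal{E}(f,s)$, $\|f\|+\sup_{k\ge 0}a^{k\alpha}\mathcal{E}(f,a^k)$, $\|f\|+\sup_{s>0}s^{\alpha}\mathcal{R}(f,s)$, $\|f\|+\sup_{k\ge 0}a^{k\alpha}\mathcal{R}(f,a^k)$.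
   Context: $\|\cdot\|$ is the norm of the Hilbert space $\mathcal{H}$. $L$ may be unbounded; $D=L^{1/2}$ is its positive square root, a self-adjoint operator with spectrum in $[0,\infty)$. Spectral transform: by the spectral theorem there are a direct integral of Hilbert spaces $X=\int X(\lambda)\,dm(\lambda)$ over $[0,\infty)$, consisting of $m$-measurable functions $\lambda\mapsto x(\lambda)\in X(\lambda)$ with finite norm $\|x\|_X=\left(\int_0^\infty\|x(\lambda)\|^2_{X(\lambda)}dm(\lambda)\right)^{1/2}$, and a unitary operator $\mathcal{F}_D:\mathcal{H}\to X$ that maps the domain of $D^k$ onto $\{x\in X:\lambda^kx\in X\}$ with $\mathcal{F}_D(D^kf)=\lambda^k\mathcal{F}_Df$. Paley-Wiener space: for $\omega>0$, $PW_\omega(D)$ is the set of $f\in\mathcal{H}$ such that $\mathcal{F}_Df$ has support in $[0,\omega]$ (i.e. $f$ lies in the range of the spectral projection of $D$ for $[0,\omega]$). Best approximation: $\mathcal{E}(f,\omega)=\inf_{g\in PW_\omega(D)}\|f-g\|$ for $f\in\mathcal{H}$, $\omega>0$. Decay functional: $\mathcal{R}(f,\omega)=\left(\int_{(\omega,\infty)}\|\mathcal{F}_D(f)(\lambda)\|^2_{X(\lambda)}\,dm(\lambda)\right)^{1/2}$, $\omega>0$. Besov space: $\mathbf{B}^\alpha_{2,q}(D)=(\mathcal{H},\mathcal{D}(D^r))^K_{\alpha/r,q}$, the real interpolation space given by Peetre's $K$-functor, where $r$ is any natural number with $r>\alpha$ and $\mathcal{D}(D^r)$ is the domain of $D^r$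 with the graph norm $\|f\|+\|D^rf\|$. That is, with $K(f,t)=\inf\{\|f_0\|+t(\|f_1\|+\|D^rf_1\|): f=f_0+f_1,\ f_0\in\mathcal{H},\ f_1\in\mathcal{D}(D^r)\}$, the norm is $\left(\int_0^\infty(t^{-\alpha/r}K(f,t))^q\frac{dt}{t}\right)^{1/q}$ (for $q=\infty$: $\sup_{t>0}t^{-\alpha/r}K(f,t)$), and the space consists of all $f\in\mathcal{H}$ for which it is finite; different choices of $r$ give equivalent norms. Two such norms, regarded as functions on $\mathcal{H}$ with values in $[0,\infty]$ (with $\|f\|_{\mathbf{B}^\alpha_{2,q}(D)}=\infty$ if $f$ is not in the space), are equivalent if each is bounded by a constant times the other, with constants independent of $f\in\mathcal{H}$. *)

(* Defs.v *)
From HB Require Import structures.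
From mathcomp Require Import all_boot all_order all_algebra.
From mathcomp Require Import complex.
From mathcomp Require Import all_classical all_reals all_analysis.

Set Implicit Arguments.
Unset Strict Implicit.
Unset Printing Implicit Defensive.

Import Order.TTheory GRing.Theory Num.Theory.
Import numFieldNormedType.Exports.

Local Open Scope classical_set_scope.
Local Open Scope ring_scope.

(* Complex Hilbert spaces: the inner product is linear in its first argument
   and induces the norm of the underlying complete normed module. *)
HB.mixin Record isHilbert (R : realType) H of CompleteNormedModule R[i] H := {
  inner : H -> H -> R[i];
  inner_linear_l : forall (a : R[i]) (x y z : H),
    inner (a *: x + y) z = a * inner x z + inner y z;
  inner_conj : forall x y : H, inner x y = (inner y x)^*;
  inner_norm : forall x : H, inner x x = `|x| ^+ 2
}.

#[short(type="hilbertType")]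
HB.structure Definition Hilbert (R : realType) :=
  {H of isHilbert R H & CompleteNormedModule R[i] H}.

(* The norm of a normed module over R[i] takes its values in R[i]. *)
Definition hnorm (R : realType) (H : hilbertType R) (x : H) : R :=
  complex.Re `|x|.

(* Possibly unbounded linear operators. The values of [op_fun] outside
   [op_dom] are irrelevant. *)
Record operator (R : realType) (H : hilbertType R) := Operator {
  op_dom : set H;
  op_fun :> H -> H;
  op_dom0 : op_dom 0;
  op_domP : forall (a : R[i]) (x y : H),
    op_dom x -> op_dom y -> op_dom (a *: x + y);
  op_linear : forall (a : R[i]) (x y : H),
    op_dom x -> op_dom y -> op_fun (a *: x + y) = a *: op_fun x + op_fun y
}.

Section Operators.
Variables (R : realType) (H : hilbertType R).
Implicit Types T L D : operator H.

(* The operator T^k is [iter k T] with domain [pow_dom T k]. *)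
Definition pow_dom T (k : nat) : set H :=
  [set x | forall j : nat, (j < k)%N -> op_dom T (iter j T x)].

Definition adjoint_graph T (y z : H) : Prop :=
  forall x, op_dom T x -> inner (T x) y = inner x z.

Definition self_adjoint T : Prop :=
  dense (op_dom T) /\
  forall y z, adjoint_graph T y z <-> op_dom T y /\ T y = z.

Definition positive_definite T : Prop :=
  forall x, op_dom T x -> x != 0 -> 0 < inner (T x) x.

Definition positive_operator T : Prop :=
  forall x, op_dom T x -> 0 <= inner (T x) x.

Definition positive_sqrt L D : Prop :=
  [/\ self_adjoint D, positive_operator D,
      op_dom L = pow_dom D 2 &
      forall x, op_dom L x -> L x = D (D x)].

End Operators.

(* Direct integrals over [0, +oo[ in the sense of Dixmier: a measure, a field
   of Hilbert spaces and a space of measurable sections. Indices are real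
   numbers, but everything below depends only on what happens on [0, +oo[.
   No countable fundamental sequence of sections is required, so that the
   fibres need not be separable, and the measure is arbitrary. *)
Record direct_integral (R : realType) := DirectIntegral {
  di_measure : {measure set (measurableTypeR R) -> \bar R};
  di_fiber :> R -> hilbertType R;
  di_meas : set (forall l : R, di_fiber l);
  di_meas0 : di_meas (fun=> 0);
  di_measP : forall (a : R[i]) x y, di_meas x -> di_meas y ->
    di_meas (fun l => a *: x l + y l);
  di_meas_norm : forall x, di_meas x ->
    measurable_fun (`[0, +oo[ : set (measurableTypeR R))
      (fun l => hnorm (x l));
  di_meas_max : forall x,
    (forall y, di_meas y ->
      measurable_fun (`[0, +oo[ : set (measurableTypeR R))
        (fun l => complex.Re (inner (x l) (y l))) /\
      measurable_fun (`[0, +oo[ : set (measurableTypeR R))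
        (fun l => complex.Im (inner (x l) (y l)))) ->
    di_meas x
}.

Section DirectIntegral.
Variables (R : realType) (X : direct_integral R).

Definition section := forall l : R, X l.

(* equality in X is equality almost everywhere on [0, +oo[ *)
Definition sec_eq (x y : section) : Prop :=
  {ae @di_measure R X, forall l : R, 0 <= l -> x l = y l}.

Definition sec_norm_on (A : set R) (x : section) : \bar R :=
  ((\int[@di_measure R X]_(l in A) ((hnorm (x l)) ^+ 2)%:E) `^ 2^-1)%E.

Definition sec_norm : section -> \bar R := sec_norm_on `[0, +oo[.

(* the section x represents an element of X *)
Definition in_X (x : section) : Prop :=
  di_meas x /\ (sec_norm x < +oo)%E.

Definition mul_pow (k : nat) (x : section) : section :=
  fun l => (l ^+ k)%:C%C *: x l.

End DirectIntegral.

(* F f is a representative of the class of the transform of f in X. *)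
Record spectral_transform (R : realType) (H : hilbertType R)
    (D : operator H) (X : direct_integral R) (F : H -> section X) : Prop := {
  st_in : forall f, in_X (F f);
  st_linear : forall (a : R[i]) f g,
    sec_eq (F (a *: f + g)) (fun l => a *: F f l + F g l);
  st_isometry : forall f, sec_norm (F f) = (hnorm f)%:E;
  st_surj : forall x : section X, in_X x -> exists f, sec_eq (F f) x;
  st_dom : forall (k : nat) f, pow_dom D k f <-> in_X (mul_pow k (F f));
  st_pow : forall (k : nat) f, pow_dom D k f ->
    sec_eq (F (iter k D f)) (mul_pow k (F f))
}.

Section Spaces.
Variables (R : realType) (H : hilbertType R) (D : operator H).
Variables (X : direct_integral R) (F : H -> section X).
Implicit Types (f g : H) (omega t alpha : R) (q : \bar R) (r : nat).

Local Open Scope ereal_scope.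

Definition paley_wiener omega : set H :=
  [set f | {ae @di_measure R X, forall l : R, (omega < l)%R -> F f l = 0%R}].

Definition best_approx f omega : \bar R :=
  ereal_inf [set (hnorm (f - g)%R)%:E | g in paley_wiener omega].

Definition decay f omega : \bar R := sec_norm_on `]omega, +oo[ (F f).

(* (\int_0^oo (u s)^q ds/s)^(1/q), resp. sup_(s > 0) u s; used for 1 <= q *)
Definition Lq_star q (u : R -> \bar R) : \bar R :=
  match q with
  | r%:E => (\int[@lebesgue_measure R]_(s in `]0%R, +oo[%classic)
               (u s `^ r * (s^-1)%:E)) `^ r^-1
  | +oo => ereal_sup [set u s | s in `]0%R, +oo[%classic]
  | -oo => 0
  end.

(* (\sum_(k >= 0) (u k)^q)^(1/q), resp. sup_(k >= 0) u k; used for 1 <= q *)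
Definition lq_seq q (u : nat -> \bar R) : \bar R :=
  match q with
  | r%:E => (\sum_(0 <= k <oo) (u k `^ r)) `^ r^-1
  | +oo => ereal_sup (range u)
  | -oo => 0
  end.

Definition graph_norm r f : R := (hnorm f + hnorm (iter r D f))%R.

Definition K_functional r f t : \bar R :=
  ereal_inf [set (hnorm f01.1 + t * graph_norm r f01.2)%:E |
             f01 in [set f01 : H * H |
                       f = (f01.1 + f01.2)%R /\ pow_dom D r f01.2]].

Definition besov_norm r alpha q f : \bar R :=
  Lq_star q (fun t => (t `^ (- (alpha / r%:R)))%:E * K_functional r f t).

Definition approx_norm_int alpha q f : \bar R :=
  (hnorm f)%:E + Lq_star q (fun s => (s `^ alpha)%:E * best_approx f s).

Definition approx_norm_sum alpha q (a : R) f : \bar R :=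
  (hnorm f)%:E +
  lq_seq q (fun k => (a `^ (k%:R * alpha))%:E * best_approx f (a ^+ k)%R).

Definition decay_norm_int alpha q f : \bar R :=
  (hnorm f)%:E + Lq_star q (fun s => (s `^ alpha)%:E * decay f s).

Definition decay_norm_sum alpha q (a : R) f : \bar R :=
  (hnorm f)%:E +
  lq_seq q (fun k => (a `^ (k%:R * alpha))%:E * decay f (a ^+ k)%R).

End Spaces.

Definition equivalent_norms (R : realType) (H : hilbertType R)
    (N1 N2 : H -> \bar R) : Prop :=
  exists c1 c2 : R, [/\ 0 < c1, 0 < c2 &
    forall f : H, (N1 f <= c1%:E * N2 f)%E /\ (N2 f <= c2%:E * N1 f)%E].

(* Main.v *)
Require Import Defs.
From mathcomp Require Import all_boot all_order all_algebra.
From mathcomp Require Import complex.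
From mathcomp Require Import all_classical all_reals all_analysis.
From mathcomp Require Import measurable_realfun ring lra.

(** All five norms are compared with one discrete quantity,
    [N f = |f| + |(a^(k alpha) R(f, a^k))_k|_(l^q)], the last of them.

    First, [E(f, s) = R(f, s)] for [s > 0]: the infimum over the Paley-Wiener
    space is attained at the spectral truncation [P_s f]
    ([spectral_projection], [best_approxE]).  This common value, the [tail] of
    [f] at [s], is nonincreasing in [s] and at most [|f|], so cutting
    [(0, oo)] at the powers of [a] compares the integral with the sum
    ([decay_int_dominated], [dominated_decay_int]); below [s = 1] the integrand
    is at most [s^alpha |f|], which contributes a geometric series.

    The Besov norm integrates [t^(-alpha/r) K(f, t)], and [K(f, .)] is
    nondecreasing and at most [|f|], so it is sampled at [t = a^(-rk)]. One has

    - [R(f, s) <= K(f, s^(-r))] ([tail_le_K]): for [f = f0 + f1], the tail of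
      [f0] is at most [|f0|], and that of [f1] at most [s^(-r) |D^r f1|]
      because the multiplier [l^r] exceeds [s^r] beyond [s].
      With [|f| <= K(f, 1)] this bounds [N] by the Besov norm;

    - [K(f, s^(-r)) <= R(f, s) + s^(-r) (|f| + |D^r P_s f|)] ([K_le_tail]),
      from the decomposition [f = (f - P_s f) + P_s f].

    The last term is treated by a Hardy inequality in the form of a recursion:
    [|D^r P_(as) f| <= |D^r P_s f| + (as)^r R(f, s)] ([trunc_pow_norm_step]), so the
    sequence [a^(k(alpha - r)) |D^r P_(a^k) f|] satisfies
    [y_(k+1) <= rho y_k + v_k] with [rho = a^(alpha - r) < 1] and [v_k] a
    multiple of [a^(k alpha) R(f, a^k)]; such a recursion bounds the [l^q] norm
    of [y] by [y_0] plus that of [v] ([lq_seq_recursion]). *)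

Set Implicit Arguments.
Unset Strict Implicit.
Unset Printing Implicit Defensive.

Import Order.TTheory GRing.Theory Num.Theory.
Import numFieldNormedType.Exports.

Local Open Scope classical_set_scope.
Local Open Scope ring_scope.

(** * Norms of sequences *)

Section SequenceNorms.
Variable R : realType.
Local Open Scope ereal_scope.

Lemma le_poweR (p : R) (x y : \bar R) :
  (0 <= p)%R -> 0 <= x -> x <= y -> x `^ p <= y `^ p.
Proof.
move=> p0 x0 xy; apply: gt0_ler_poweR => //.
  by rewrite in_itv /= x0 leey.
by rewrite in_itv /= (le_trans x0 xy) leey.
Qed.

(** The larger summand absorbs the smaller one, at the cost of a factor 2.  This
    crude form holds for every exponent, so that it serves both for the power
    [p] inside the sums and for the root [1/p] outside. *)
Lemma poweRD_le (p : R) (x y : \bar R) : (0 <= p)%R -> 0 <= x -> 0 <= y ->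
  (x + y) `^ p <= (2 `^ p)%:E * (x `^ p + y `^ p).
Proof.
move=> p0.
have H u v : 0 <= u -> u <= v ->
    (u + v) `^ p <= (2 `^ p)%:E * (u `^ p + v `^ p).
  move=> u0 uv; have v0 := le_trans u0 uv.
  apply: (@le_trans _ _ ((2%:E * v) `^ p)).
    apply: le_poweR => //; first exact: adde_ge0.
    by rewrite (_ : 2%:E = 1 + 1)// ge0_muleDl// !mul1e leeD2r.
  rewrite poweRM//.
  rewrite poweR_EFin lee_pmul2l ?lte_fin ?powR_gt0//.
  by rewrite leeDr ?poweR_ge0.
move=> x0 y0; have [xy|/ltW yx] := leP x y; first exact: H.
by rewrite addeC (addeC (x `^ p)); exact: H.
Qed.

Lemma powRVK (p x : R) : (0 < p)%R -> (0 <= x)%R -> ((x `^ p) `^ p^-1 = x)%R.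
Proof. by move=> p0 x0; rewrite -powRrM divff ?gt_eqF// powRr1. Qed.

Lemma lq_seq_ge0 (q : \bar R) u : 0 < q -> (forall k, 0 <= u k) -> 0 <= lq_seq q u.
Proof.
case: q => [p| |] // _ u0 /=; first exact: poweR_ge0.
by apply: le_trans (u0 0%N) _; apply: ereal_sup_ubound; exists 0%N.
Qed.

Lemma le_lq_seq (q : \bar R) u v : 0 < q -> (forall k, 0 <= u k) ->
  (forall k, u k <= v k) -> lq_seq q u <= lq_seq q v.
Proof.
case: q => [p| |] //= q0 u0 uv.
  have p0 : (0 <= p)%R by rewrite -lee_fin ltW.
  apply: le_poweR; rewrite ?invr_ge0//.
    by apply: nneseries_ge0 => k _ _; exact: poweR_ge0.
  by apply: lee_nneseries => [k _ _|k _]; [exact: poweR_ge0|exact: le_poweR].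
apply: ge_ereal_sup => _ [k _ <-]; apply: le_trans (uv k) _.
by apply: ereal_sup_ubound; exists k.
Qed.

Lemma lq_seq_ge_term (q : \bar R) u k : 0 < q -> (forall k, 0 <= u k) ->
  u k <= lq_seq q u.
Proof.
case: q => [p| |] //= q0 u0; last by apply: ereal_sup_ubound; exists k.
rewrite lte_fin in q0.
apply: (@le_trans _ _ ((u k `^ p) `^ p^-1)).
  by rewrite -poweRrM divff ?gt_eqF// poweRe1.
apply: le_poweR; rewrite ?invr_ge0 ?(ltW q0) ?poweR_ge0//.
rewrite (nneseriesD1 (n := k))//; last by move=> *; exact: poweR_ge0.
by rewrite leeDl// nneseries_ge0// => *; exact: poweR_ge0.
Qed.

Lemma lq_seqZ_le (q : \bar R) (c : R) (u : nat -> R) : 0 < q -> (0 <= c)%R ->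
  (forall k, (0 <= u k)%R) ->
  lq_seq q (fun k => (c * u k)%:E) <= c%:E * lq_seq q (fun k => (u k)%:E).
Proof.
move=> q0 c0 u0; case: q q0 => [p| |] // q0; rewrite /lq_seq; last first.
  apply: ge_ereal_sup => _ [k _ <-]; rewrite EFinM.
  apply: lee_wpmul2l; first by rewrite lee_fin.
  by apply: ereal_sup_ubound; exists k.
rewrite lte_fin in q0.
under eq_eseriesr do rewrite EFinM poweRM ?lee_fin// poweR_EFin.
rewrite nneseriesZl; last by move=> *; exact: poweR_ge0.
rewrite poweRM ?lee_fin ?powR_ge0//; last first.
  by apply: nneseries_ge0 => *; exact: poweR_ge0.
by rewrite poweR_EFin powRVK.
Qed.

(** A quasi-triangle inequality: [poweRD_le] is used once under the sum and once
    for the root. A constant above 1 does no harm to equivalence of norms. *)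
Lemma lq_seqD_le (q : \bar R) : 0 < q -> exists2 C : R, (0 < C)%R &
  forall u v : nat -> R, (forall k, (0 <= u k)%R) -> (forall k, (0 <= v k)%R) ->
  lq_seq q (fun k => (u k + v k)%:E) <=
    C%:E * (lq_seq q (fun k => (u k)%:E) + lq_seq q (fun k => (v k)%:E)).
Proof.
case: q => [p| |] // q0; rewrite /lq_seq; last first.
  exists 1%R => // u v u0 v0; rewrite mul1e; apply: ge_ereal_sup => _ [k _ <-].
  by rewrite EFinD; apply: leeD; apply: ereal_sup_ubound; exists k.
rewrite lte_fin in q0.
exists (2 * 2 `^ p^-1)%R; first by rewrite mulr_gt0 ?powR_gt0.
move=> u v u0 v0.
have U0 (w : nat -> \bar R) : 0 <= \sum_(0 <= k <oo) (w k `^ p).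
  by apply: nneseries_ge0 => *; exact: poweR_ge0.
apply: (@le_trans _ _ (((2 `^ p)%:E *
   (\sum_(0 <= k <oo) ((u k)%:E `^ p) + \sum_(0 <= k <oo) ((v k)%:E `^ p)))
     `^ p^-1)).
  apply: le_poweR; rewrite ?invr_ge0 ?(ltW q0) ?U0//.
  rewrite -nneseriesD; try by move=> *; exact: poweR_ge0.
  rewrite -nneseriesZl; last by move=> *; rewrite adde_ge0 ?poweR_ge0.
  apply: lee_nneseries => [*|k _]; first exact: poweR_ge0.
  by rewrite EFinD; apply: poweRD_le; rewrite ?(ltW q0) ?lee_fin.
rewrite poweRM ?lee_fin ?powR_ge0 ?adde_ge0// poweR_EFin powRVK//.
rewrite EFinM -muleA; apply: lee_wpmul2l; first by rewrite lee_fin.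
by apply: poweRD_le; rewrite ?invr_ge0 ?(ltW q0).
Qed.

(** The constant [C] absorbs the case where [v] is not negligible before [y]:
    if [v <= eps y] then [rho y + v <= (rho + eps) y], and otherwise
    [rho y + v <= (rho / eps + 1) v]. Any [eps] with [rho + eps < 1] will do. *)
Lemma powR_contraction (p rho : R) : (0 < p)%R -> (0 <= rho < 1)%R ->
  exists kappa C : R, [/\ (0 <= kappa < 1)%R, (0 < C)%R &
    forall y v : R, (0 <= y)%R -> (0 <= v)%R ->
      ((rho * y + v) `^ p <= kappa * y `^ p + C * v `^ p)%R].
Proof.
move=> p0 /andP[rho0 rho1].
pose eps : R := ((1 - rho) / 2)%R.
have eps0 : (0 < eps)%R by rewrite /eps; lra.
exists ((rho + eps) `^ p)%R, ((rho / eps + 1) `^ p)%R; split.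
- rewrite powR_ge0/=.
  suff : ((rho + eps) `^ p < 1 `^ p)%R by rewrite powR1.
  by apply: gt0_ltr_powR; rewrite // ?nnegrE /eps; lra.
- by rewrite powR_gt0// ltr_wpDl// divr_ge0// ltW.
move=> y v y0 v0.
have re0 : (0 <= rho + eps)%R by rewrite addr_ge0// ltW.
have rf0 : (0 <= rho / eps + 1)%R by rewrite addr_ge0// divr_ge0// ltW.
rewrite -!powRM//.
have [vy|yv] := leP v (eps * y)%R.
  apply: (@le_trans _ _ (((rho + eps) * y) `^ p)%R); last by rewrite lerDl powR_ge0.
  by apply: ge0_ler_powR; rewrite ?(ltW p0)// ?nnegrE ?addr_ge0 ?mulr_ge0// mulrDl lerD2l.
apply: (@le_trans _ _ (((rho / eps + 1) * v) `^ p)%R); last by rewrite lerDr powR_ge0.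
apply: ge0_ler_powR; rewrite ?(ltW p0)// ?nnegrE ?addr_ge0 ?mulr_ge0//.
rewrite mulrDl mul1r lerD2r mulrAC ler_pdivlMr//.
by rewrite -mulrA ler_wpM2l// mulrC ltW.
Qed.

(** The discrete Hardy inequality. The [p]-th powers obey the same kind of
    recursion with a ratio [kappa < 1], so that summing it gives
    [sum y^p <= y_0^p + kappa sum y^p + C sum v^p], and the middle term can be
    absorbed on the left. *)
Lemma lq_seq_recursion (q : \bar R) (rho : R) : 0 < q -> (0 <= rho < 1)%R ->
  exists2 C : R, (0 < C)%R & forall y v : nat -> R,
    (forall k, (0 <= y k)%R) -> (forall k, (0 <= v k)%R) ->
    (forall k, (y k.+1 <= rho * y k + v k)%R) ->
    lq_seq q (fun k => (y k)%:E) <=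
      C%:E * ((y 0%N)%:E + lq_seq q (fun k => (v k)%:E)).
Proof.
case: q => [p| |] // q0 rho01; rewrite /lq_seq.
- rewrite lte_fin in q0.
  have [kappa [c [/andP[k0 k1] c0 Hc]]] := powR_contraction q0 rho01.
  pose M : R := ((1 + c) / (1 - kappa))%R.
  have M0 : (0 < M)%R by rewrite divr_gt0 ?subr_gt0// ltr_wpDr// ltW.
  exists (M `^ p^-1 * 2 `^ p^-1)%R; first by rewrite mulr_gt0 ?powR_gt0.
  move=> y v y0 v0 yv.
  (* Absorption needs a finite sum, hence partial sums. *)
  have partial n : (\sum_(0 <= k < n) y k `^ p <=
      M * (y 0%N `^ p + \sum_(0 <= k < n) v k `^ p))%R.
    have Y0 : (0 <= \sum_(0 <= k < n) y k `^ p)%R.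
      by rewrite sumr_ge0// => *; exact: powR_ge0.
    have V0 : (0 <= \sum_(0 <= k < n) v k `^ p)%R.
      by rewrite sumr_ge0// => *; exact: powR_ge0.
    have y00 := powR_ge0 (y 0%N) p.
    suff : (\sum_(0 <= k < n) y k `^ p <= y 0%N `^ p +
        kappa * \sum_(0 <= k < n) y k `^ p + c * \sum_(0 <= k < n) v k `^ p)%R.
      rewrite /M mulrAC ler_pdivlMr ?subr_gt0//; nra.
    apply: (@le_trans _ _ (\sum_(0 <= k < n.+1) y k `^ p)%R).
      by rewrite big_nat_recr//= lerDl powR_ge0.
    rewrite big_nat_recl//= -addrA lerD2l !mulr_sumr -big_split /=.
    apply: ler_sum => k _; apply: le_trans (Hc _ _ (y0 k) (v0 k)).
    by apply: ge0_ler_powR; rewrite ?(ltW q0)// ?nnegrE// (le_trans _ (yv k)).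
  apply: (@le_trans _ _ ((M%:E *
      ((y 0%N)%:E `^ p + \sum_(0 <= k <oo) ((v k)%:E `^ p))) `^ p^-1)).
    apply: le_poweR; rewrite ?invr_ge0 ?(ltW q0)//.
      by apply: nneseries_ge0 => *; exact: poweR_ge0.
    apply: lime_le; first by apply: is_cvg_nneseries => k _ _; exact: poweR_ge0.
    apply: nearW => n.
    under eq_bigr do rewrite poweR_EFin.
    rewrite sumEFin; apply: (@le_trans _ _ _%:E); first by rewrite lee_fin; exact: partial.
    rewrite EFinM; apply: lee_wpmul2l; first by rewrite lee_fin ltW.
    rewrite EFinD poweR_EFin leeD2l// -sumEFin.
    by apply: (nneseries_lim_ge (u_ := fun k => (v k)%:E `^ p) (P := xpredT)) => *; exact: poweR_ge0.
  have V0 : 0 <= \sum_(0 <= k <oo) ((v k)%:E `^ p).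
    by apply: nneseries_ge0 => *; exact: poweR_ge0.
  rewrite poweRM ?lee_fin ?(ltW M0) ?adde_ge0 ?poweR_ge0//.
  rewrite poweR_EFin EFinM -muleA; apply: lee_wpmul2l; first by rewrite lee_fin powR_ge0.
  apply: le_trans (poweRD_le _ _ _) _; rewrite ?invr_ge0 ?(ltW q0) ?poweR_ge0//.
  by rewrite poweR_EFin poweR_EFin powRVK.
- case/andP: rho01 => rho0 rho1.
  pose M : R := (1 - rho)^-1%R.
  have M1 : (1 <= M)%R by rewrite /M invf_ge1 ?subr_gt0// gerBl.
  exists M; first exact: lt_le_trans M1.
  move=> y v y0 v0 yv; set V := ereal_sup (range (fun k => (v k)%:E)).
  have vV k : (v k)%:E <= V by apply: ereal_sup_ubound; exists k.
  have V0 : 0 <= V by apply: le_trans (vV 0%N); rewrite lee_fin.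
  apply: ge_ereal_sup => _ [k _ <-].
  case: V V0 vV => [V V0 vV| |//]; last first.
    by move=> _ _; rewrite addey// gt0_muley ?leey// lte_fin (lt_le_trans _ M1).
  rewrite -EFinD -EFinM lee_fin.
  have Mr : (rho * M + 1 = M)%R.
    by rewrite /M; field; rewrite subr_eq0 gt_eqF.
  rewrite lee_fin in V0.
  elim: k => [|k IH]; first by have := y0 0%N; nra.
  apply: le_trans (yv k) _.
  have := vV k; rewrite lee_fin; have := y0 0%N.
  have : (rho * y k <= rho * (M * (y 0%N + V)))%R by rewrite ler_wpM2l.
  rewrite mulrA (_ : rho * M = M - 1)%R; last lra.
  nra.
Qed.

End SequenceNorms.

(** * Comparison of integrals with series *)

Section Integrals.
Context d (T : measurableType d) (R : realType) (mu : {measure set T -> \bar R}).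
Local Open Scope ereal_scope.

(** The integral of a nonnegative function is a supremum over the simple
    functions below it, hence monotone on all nonnegative functions. It is
    applied to integrands such as [t^(-alpha/r) K(f, t)], whose measurability
    would otherwise have to be derived from the monotonicity of [K]. *)
Lemma le_integral_nonmeasurable (D : set T) (f g : T -> \bar R) :
  (forall x, D x -> 0 <= f x) -> (forall x, D x -> f x <= g x) ->
  \int[mu]_(x in D) f x <= \int[mu]_(x in D) g x.
Proof.
move=> f0 fg; have g0 x : D x -> 0 <= g x.
  by move=> Dx; apply: le_trans (f0 x Dx) (fg x Dx).
rewrite !ge0_integralE//= ge_ereal_sup// => _ [h /= hf] <-.
apply: ereal_sup_ubound; exists h => //= x; apply: le_trans (hf x) _.
by rewrite !patchE; case: ifPn => // /set_mem; exact: fg.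
Qed.

(** The three step-function lemmas let an arbitrary integrand be compared with
    the countable sum of weighted indicators that corresponds to a series. *)
Lemma integral_step (D : set T) (x : nat -> R) (I : nat -> set T) :
  measurable D -> (forall k, (0 <= x k)%R) -> (forall k, measurable (I k)) ->
  \int[mu]_(s in D) \sum_(k <oo) ((x k)%:E * (\1_(I k) s)%:E) =
  \sum_(k <oo) ((x k)%:E * mu (I k `&` D)).
Proof.
move=> mD x0 mI.
have mind k : measurable_fun D (EFin \o (\1_(I k) : T -> R)).
  by apply/measurable_EFinP; exact: measurable_indic.
rewrite integral_nneseries//.
- apply: eq_eseriesr => k _; rewrite ge0_integralZl_EFin//; last exact: mind.
  by rewrite integral_indic.
- by move=> k; apply: measurable_funeM; exact: mind.
- by move=> k s _; rewrite mule_ge0// lee_fin.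
Qed.

Lemma step_ge_term (x : nat -> R) (I : nat -> set T) k s :
  (forall k, (0 <= x k)%R) -> I k s ->
  (x k)%:E <= \sum_(k <oo) ((x k)%:E * (\1_(I k) s)%:E).
Proof.
move=> x0 Is; rewrite (nneseriesD1 (n := k))//; last first.
  by move=> j _; rewrite mule_ge0// lee_fin.
rewrite indicE mem_set// mule1 leeDl// nneseries_ge0// => j _ _.
by rewrite mule_ge0// lee_fin.
Qed.

Lemma step_le (x : nat -> R) (I : nat -> set T) s (M : \bar R) :
  (forall k, (0 <= x k)%R) -> trivIset setT I -> 0 <= M ->
  (forall k, I k s -> (x k)%:E <= M) ->
  \sum_(k <oo) ((x k)%:E * (\1_(I k) s)%:E) <= M.
Proof.
move=> x0 tI M0 xM.
have [[k Iks]|nI] := pselect (exists k, I k s); last first.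
  rewrite eseries0// => k _ _; rewrite indicE memNset ?mule0// => Iks.
  by apply: nI; exists k.
rewrite (nneseriesD1 (n := k))//; last first.
  by move=> j _; rewrite mule_ge0// lee_fin.
rewrite indicE mem_set// mule1 eseries0 ?adde0; first exact: xM.
move=> j _ /= jk; rewrite indicE memNset ?mule0// => Ijs.
move/eqP: jk; apply; apply: tI => //; by exists s.
Qed.

End Integrals.

Section Discretization.
Variable R : realType.
Local Open Scope ereal_scope.

Lemma Lq_star_ge0 (q : \bar R) (u : R -> \bar R) : 0 < q ->
  (forall s, (0 < s)%R -> 0 <= u s) -> 0 <= Lq_star q u.
Proof.
case: q => [p| |] // q0 u0 /=; first exact: poweR_ge0.
apply: le_trans (u0 1%R ltr01) _; apply: ereal_sup_ubound.
by exists 1%R => //=; rewrite in_itv/= ltr01.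
Qed.

Lemma geometric_cover (b s : R) : (1 < b)%R -> (1 <= s)%R ->
  exists k : nat, (b ^+ k <= s <= b ^+ k.+1)%R.
Proof.
move=> b1 s1; have b0 : (0 < b)%R by apply: lt_trans b1.
have s0 : (0 < s)%R by apply: lt_le_trans s1.
have lb : (0 < ln b)%R by rewrite ln_gt0.
have powE n : (b ^+ n = expR (n%:R * ln b))%R.
  by rewrite expRM_natl lnK// posrE.
have x0 : (0 <= ln s / ln b)%R by apply: divr_ge0; [exact: ln_ge0|exact: ltW].
exists (Num.truncn (ln s / ln b)); rewrite !powE -[X in (_ <= X <= _)%R](@lnK R)// !ler_expR.
have /andP[h1 h2] := truncn_itv x0.
apply/andP; split.
  by rewrite -ler_pdivlMr.
by rewrite -ler_pdivrMr// ltW.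
Qed.

(** Each interval from [c] to [bc] has measure [(b - 1) c], whereas [1/s]
    is at most [1/c] there: every interval contributes at most [(b - 1) W^p].
    The intervals may overlap at the endpoints, since only an upper bound by a
    sum of indicators is needed. *)
Lemma Lq_star_le_lq (q : \bar R) (b : R) : 0 < q -> (1 < b)%R ->
  exists2 C : R, (0 < C)%R & forall (u : R -> \bar R) (W W' : nat -> R),
    (forall s, (0 < s)%R -> 0 <= u s) ->
    (forall k, (0 <= W k)%R) -> (forall k, (0 <= W' k)%R) ->
    (forall k s, (b ^+ k <= s <= b ^+ k.+1)%R -> u s <= (W k)%:E) ->
    (forall k s, (b ^- k.+1 <= s <= b ^- k)%R -> u s <= (W' k)%:E) ->
    Lq_star q u <= C%:E * (lq_seq q (fun k => (W k)%:E) +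
                           lq_seq q (fun k => (W' k)%:E)).
Proof.
move=> q0 b1; have b0 : (0 < b)%R by apply: lt_trans b1.
have cover s : (0 < s)%R -> (exists k, (b ^+ k <= s <= b ^+ k.+1)%R) \/
    (exists k, (b ^- k.+1 <= s <= b ^- k)%R).
  move=> s0; have [s1|/ltW s1] := leP 1%R s; first by left; exact: geometric_cover.
  right; have [|k /andP[h1 h2]] := geometric_cover (s := s^-1) b1.
    by rewrite invf_ge1.
  exists k; rewrite -(invrK s) !lef_pV2 ?posrE ?exprn_gt0 ?invr_gt0//.
  by rewrite h1 h2.
case: q q0 => [p| |] // q0; rewrite /lq_seq /Lq_star; last first.
  exists 1%R => // u W W' u0 W0 W'0 uW uW'; rewrite mul1e.
  have S0 (w : nat -> R) : (forall k, (0 <= w k)%R) ->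
      0 <= ereal_sup (range (fun k => (w k)%:E)).
    move=> w0; apply: (@le_trans _ _ (w 0%N)%:E); first by rewrite lee_fin.
    by apply: ereal_sup_ubound; exists 0%N.
  apply: ge_ereal_sup => _ [s /= + <-]; rewrite in_itv/= andbT => s0.
  have [[k ks]|[k ks]] := cover s s0.
    apply: le_trans (uW k s ks) _; apply: le_trans (leeDl _ (S0 _ W'0)).
    by apply: ereal_sup_ubound; exists k.
  apply: le_trans (uW' k s ks) _; apply: le_trans (leeDr _ (S0 _ W0)).
  by apply: ereal_sup_ubound; exists k.
rewrite lte_fin in q0; have p0 := ltW q0.
have bb0 : (0 < b - 1)%R by rewrite subr_gt0.
exists ((b - 1) `^ p^-1 * 2 `^ p^-1)%R; first by rewrite mulr_gt0 ?powR_gt0.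
move=> u W W' u0 W0 W'0 uW uW'.
pose I (k : nat) : set R := `[(b ^+ k)%R, (b ^+ k.+1)%R]%classic.
pose I' (k : nat) : set R := `[(b ^- k.+1)%R, (b ^- k)%R]%classic.
pose x k := (W k `^ p / b ^+ k)%R; pose x' k := (W' k `^ p * b ^+ k.+1)%R.
have x0 k : (0 <= x k)%R by rewrite divr_ge0 ?powR_ge0 ?exprn_ge0 ?(ltW b0).
have x'0 k : (0 <= x' k)%R by rewrite mulr_ge0 ?powR_ge0 ?exprn_ge0 ?(ltW b0).
have mI k : measurable (I k) by exact: measurable_itv.
have mI' k : measurable (I' k) by exact: measurable_itv.
pose g (y : nat -> R) (J : nat -> set R) s := \sum_(k <oo) ((y k)%:E * (\1_(J k) s)%:E).
have g0 y J s : (forall k, (0 <= y k)%R) -> 0 <= g y J s.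
  by move=> y0; apply: nneseries_ge0 => k _ _; rewrite mule_ge0// lee_fin.
have mg y J : (forall k, (0 <= y k)%R) -> (forall k, measurable (J k)) ->
    measurable_fun (`]0%R, +oo[%classic : set R) (g y J).
  move=> y0 mJ; apply: (ge0_emeasurable_sum (P := xpredT)) => k.
    by move=> *; rewrite mule_ge0// lee_fin.
  by move=> _; apply: measurable_funeM; apply/measurable_EFinP; exact: measurable_indic.
have upper s : (0 < s)%R -> u s `^ p * (s^-1)%:E <= g x I s + g x' I' s.
  move=> s0; have [[k ks]|[k ks]] := cover s s0.
    apply: le_trans (leeDl _ (g0 _ _ _ x'0)).
    apply: le_trans (step_ge_term (k := k) x0 _); last by rewrite /I/= in_itv.
    rewrite /x EFinM -poweR_EFin; apply: lee_pmul; rewrite ?poweR_ge0//.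
    - by rewrite lee_fin invr_ge0 ltW.
    - by apply: le_poweR => //; [exact: u0|exact: uW ks].
    - case/andP: ks => ks _.
      by rewrite lee_fin lef_pV2// posrE exprn_gt0.
  apply: le_trans (leeDr _ (g0 _ _ _ x0)).
  apply: le_trans (step_ge_term (k := k) x'0 _); last by rewrite /I'/= in_itv.
  rewrite /x' EFinM -poweR_EFin; apply: lee_pmul; rewrite ?poweR_ge0//.
  - by rewrite lee_fin invr_ge0 ltW.
  - by apply: le_poweR => //; [exact: u0|exact: uW' ks].
  - case/andP: ks => ks _.
    by rewrite lee_fin -[X in (_ <= X)%R]invrK lef_pV2// posrE invr_gt0 exprn_gt0.
have intE (y : nat -> R) (J : nat -> set R) (w c : nat -> R) : (forall k, (0 <= y k)%R) ->
    (forall k, measurable (J k)) -> (forall k, J k `<=` `]0%R, +oo[%classic) ->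
    (forall k, lebesgue_measure (J k) = (c k)%:E) ->
    (forall k, (y k * c k = (b - 1) * w k `^ p)%R) ->
    \int[@lebesgue_measure R]_(s in `]0%R, +oo[%classic) g y J s =
    (b - 1)%:E * \sum_(0 <= k <oo) ((w k)%:E `^ p).
  move=> y0 mJ J0 Jc yc; rewrite integral_step//.
  rewrite -nneseriesZl; last by move=> *; exact: poweR_ge0.
  apply: eq_eseriesr => k _; rewrite setIidl//.
  rewrite [X in _ * X](_ : _ = (c k)%:E); last exact: Jc.
  by rewrite poweR_EFin -!EFinM yc.
have sumW (w : nat -> R) : 0 <= \sum_(0 <= k <oo) ((w k)%:E `^ p).
  by apply: nneseries_ge0 => *; exact: poweR_ge0.
have : \int[@lebesgue_measure R]_(s in `]0%R, +oo[%classic) (u s `^ p * (s^-1)%:E) <=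
    (b - 1)%:E * (\sum_(0 <= k <oo) ((W k)%:E `^ p) + \sum_(0 <= k <oo) ((W' k)%:E `^ p)).
  rewrite ge0_muleDr// -(intE x I W (fun k => b ^+ k * (b - 1))%R)//; last 3 first.
  - move=> k s; rewrite /I/= !in_itv/= andbT => /andP[h _].
    by apply: lt_le_trans h; rewrite exprn_gt0.
  - move=> k; rewrite /I; have := lebesgue_measure_itv `[b ^+ k, b ^+ k.+1]%R => /= ->.
    rewrite lte_fin ltr_eXn2l// ltnSn -EFinB; congr _%:E; rewrite exprSr; ring.
  - move=> k; rewrite /x; field; rewrite ?expf_neq0 ?lt0r_neq0//=.
  rewrite -(intE x' I' W' (fun k => b ^- k.+1 * (b - 1))%R)//; last 3 first.
  - move=> k s; rewrite /I'/= !in_itv/= andbT => /andP[h _].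
    by apply: lt_le_trans h; rewrite invr_gt0 exprn_gt0.
  - move=> k; rewrite /I'; have := lebesgue_measure_itv `[b ^- k.+1, b ^- k]%R => /= ->.
    rewrite lte_fin ltf_pV2 ?posrE ?exprn_gt0// ltr_eXn2l// ltnSn -EFinB; congr _%:E.
    by rewrite exprSr; field; rewrite ?expf_neq0 ?lt0r_neq0//=.
  - by move=> k; rewrite /x'; field; rewrite ?expf_neq0 ?lt0r_neq0//=.
  rewrite -ge0_integralD//; last 4 first.
  - by move=> s _; exact: g0.
  - exact: mg.
  - by move=> s _; exact: g0.
  - exact: mg.
  apply: le_integral_nonmeasurable => s; rewrite /= in_itv/= andbT => s0.
    by rewrite mule_ge0 ?poweR_ge0// lee_fin invr_ge0 ltW.
  exact: upper.
move=> H; apply: le_trans (le_poweR _ _ H) _; rewrite ?invr_ge0//.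
  apply: integral_ge0 => s; rewrite /= in_itv/= andbT => s0.
  by rewrite mule_ge0 ?poweR_ge0// lee_fin invr_ge0 ltW.
rewrite poweRM ?lee_fin ?(ltW bb0) ?adde_ge0// poweR_EFin EFinM -muleA.
apply: lee_wpmul2l; first by rewrite lee_fin powR_ge0.
by apply: poweRD_le; rewrite ?invr_ge0.
Qed.

(** Converse to the previous lemma: for [c <= s < bc] one has [1/s >= 1/(bc)], hence
    an interval contributes at least [(1 - 1/b) w^p], and disjointness makes the
    contributions add up. *)
Lemma lq_le_Lq_star (q : \bar R) (b : R) : 0 < q -> (1 < b)%R ->
  exists2 C : R, (0 < C)%R & forall (u : R -> \bar R) (w c : nat -> R),
    (forall s, (0 < s)%R -> 0 <= u s) -> (forall k, (0 <= w k)%R) ->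
    (forall k, (0 < c k)%R) ->
    trivIset setT (fun k => `[c k, (b * c k)%R[%classic : set R) ->
    (forall k s, (c k <= s < b * c k)%R -> (w k)%:E <= u s) ->
    lq_seq q (fun k => (w k)%:E) <= C%:E * Lq_star q u.
Proof.
move=> q0 b1; have b0 : (0 < b)%R by apply: lt_trans b1.
case: q q0 => [p| |] // q0; rewrite /lq_seq /Lq_star; last first.
  exists 1%R => // u w c u0 w0 c0 _ wu; rewrite mul1e.
  apply: ge_ereal_sup => _ [k _ <-].
  apply: (@le_trans _ _ (u (c k))).
    by apply: wu; rewrite lexx/= ltr_pMl.
  by apply: ereal_sup_ubound; exists (c k) => //=; rewrite in_itv/= c0.
rewrite lte_fin in q0; have p0 := ltW q0.
pose M := (b / (b - 1))%R.
have M0 : (0 < M)%R by rewrite divr_gt0// subr_gt0.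
exists (M `^ p^-1)%R; first by rewrite powR_gt0.
move=> u w c u0 w0 c0 tI wu.
pose I (k : nat) : set R := `[c k, (b * c k)%R[%classic.
pose x k := (w k `^ p / (b * c k))%R.
have bc0 k : (0 < b * c k)%R by rewrite mulr_gt0.
have x0 k : (0 <= x k)%R by rewrite divr_ge0 ?powR_ge0 ?(ltW (bc0 k)).
have mI k : measurable (I k) by exact: measurable_itv.
have int0 : 0 <= \int[@lebesgue_measure R]_(s in `]0%R, +oo[%classic) (u s `^ p * (s^-1)%:E).
  apply: integral_ge0 => s; rewrite /= in_itv/= andbT => s0.
  by rewrite mule_ge0 ?poweR_ge0// lee_fin invr_ge0 ltW.
have : \sum_(0 <= k <oo) ((w k)%:E `^ p) <=
    M%:E * \int[@lebesgue_measure R]_(s in `]0%R, +oo[%classic) (u s `^ p * (s^-1)%:E).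
  rewrite (_ : \sum_(0 <= k <oo) _ = M%:E * \int[@lebesgue_measure R]_(s in `]0%R, +oo[%classic)
      \sum_(k <oo) ((x k)%:E * (\1_(I k) s)%:E)); last first.
    rewrite integral_step// -nneseriesZl; last by move=> k _; rewrite mule_ge0// lee_fin.
    apply: eq_eseriesr => k _; rewrite setIidl; last first.
      move=> s; rewrite /I/= !in_itv/= andbT => /andP[h _].
      exact: lt_le_trans h.
    rewrite /I; have := lebesgue_measure_itv `[c k, b * c k[%R => /= ->.
    rewrite lte_fin ltr_pMl// b1 -EFinB -!EFinM; congr _%:E.
    rewrite /M /x; field; rewrite !lt0r_neq0 ?subr_gt0//=.
  apply: lee_wpmul2l; first by rewrite lee_fin ltW.
  apply: le_integral_nonmeasurable => s; rewrite /= in_itv/= andbT => s0.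
    by apply: nneseries_ge0 => k _ _; rewrite mule_ge0// lee_fin.
  apply: step_le => // [|k].
    by rewrite mule_ge0 ?poweR_ge0// lee_fin invr_ge0 ltW.
  rewrite /I/= in_itv/= => ks.
  rewrite /x EFinM -poweR_EFin; apply: lee_pmul; rewrite ?poweR_ge0//.
  - by rewrite lee_fin invr_ge0 ltW.
  - by apply: le_poweR => //; [rewrite lee_fin|exact: wu ks].
  - case/andP: ks => _ /ltW ks.
    by rewrite lee_fin lef_pV2// posrE.
move=> H; apply: le_trans (le_poweR _ _ H) _; rewrite ?invr_ge0//.
  by apply: nneseries_ge0 => *; exact: poweR_ge0.
by rewrite poweRM ?lee_fin ?(ltW M0)// poweR_EFin.
Qed.

End Discretization.

(** * Hilbert spaces and measurable sections *)

Section HilbertNorm.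
Variables (R : realType) (H : hilbertType R).
Implicit Types x y z : H.

Lemma normE x : `|x| = (hnorm x)%:C%C.
Proof.
rewrite /hnorm; have := normr_ge0 x; case: `|x| => a b.
by rewrite lecE/= => /andP[/eqP -> _].
Qed.

Lemma hnorm_ge0 x : 0 <= hnorm x.
Proof. by have := normr_ge0 x; rewrite normE lecR. Qed.

Lemma hnorm_triangle x y : hnorm (x + y) <= hnorm x + hnorm y.
Proof. by have := ler_normD x y; rewrite !normE -rmorphD lecR. Qed.

Lemma hnorm_zero : hnorm (0 : H) = 0.
Proof. by rewrite /hnorm normr0. Qed.

Lemma hnormZ_real (c : R) x : 0 <= c -> hnorm (c%:C%C *: x) = c * hnorm x.
Proof.
move=> c0; have : (hnorm (c%:C%C *: x))%:C%C = (c * hnorm x)%:C%C :> R[i].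
  by rewrite -normE normrZ normE rmorphM/= ger0_norm// lecR.
by case.
Qed.

Lemma inner0l y : inner (0 : H) y = 0.
Proof.
have := inner_linear_l (-1) (0 : H) 0 y.
by rewrite scaler0 addr0 mulN1r addrC subrr.
Qed.

Lemma innerDl x y z : inner (x + y) z = inner x z + inner y z.
Proof. by have := inner_linear_l 1 x y z; rewrite scale1r mul1r. Qed.

Lemma innerZl a x y : inner (a *: x) y = a * inner x y.
Proof. by have := inner_linear_l a x 0 y; rewrite inner0l !addr0. Qed.

(** Polarization, the reason why measurability of norms passes to inner
    products of measurable sections. *)
Lemma Re_inner x y : complex.Re (inner x y) =
  (hnorm (x + y) ^+ 2 - hnorm x ^+ 2 - hnorm y ^+ 2) / 2.
Proof.
have sq z : complex.Re (inner z z) = hnorm z ^+ 2.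
  by rewrite inner_norm normE -rmorphXn.
have Rs z w : complex.Re (inner z w) = complex.Re (inner w z).
  by rewrite inner_conj; case: (inner w z).
have ReD (z w : R[i]) : complex.Re (z + w) = complex.Re z + complex.Re w.
  by case: z; case: w.
rewrite -!sq innerDl ReD (Rs x (x + y)) (Rs y (x + y)) !innerDl !ReD (Rs y x).
lra.
Qed.

Lemma Im_inner x y : complex.Im (inner x y) = - complex.Re (inner ('i%C *: x) y).
Proof. by rewrite innerZl; case: (inner x y) => a b /=; ring. Qed.

End HilbertNorm.

Section Sections.
Variables (R : realType) (X : direct_integral R).
Implicit Types x y : section X.
Local Notation half_line := (`[0, +oo[%classic : set (measurableTypeR R)).

Lemma di_meas_inner x y : di_meas x -> di_meas y ->
  measurable_fun half_line (fun l => complex.Re (inner (x l) (y l))) /\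
  measurable_fun half_line (fun l => complex.Im (inner (x l) (y l))).
Proof.
have mRe (u v : section X) : di_meas u -> di_meas v ->
    measurable_fun half_line (fun l => complex.Re (inner (u l) (v l))).
  move=> mu mv; rewrite (_ : (fun l => _) = (fun l =>
      (hnorm (u l + v l) ^+ 2 - hnorm (u l) ^+ 2 - hnorm (v l) ^+ 2) / 2));
    last by apply/funext => l; rewrite Re_inner.
  have muv : di_meas (fun l => u l + v l).
    have := di_measP 1 mu mv.
    by congr di_meas; apply: functional_extensionality_dep => l; rewrite scale1r.
  apply: measurable_funM; last exact: measurable_cst.
  apply: measurable_funB; first apply: measurable_funB;
    by apply: measurable_funX; exact: di_meas_norm.
move=> mx my; split; first exact: mRe.
rewrite (_ : (fun l => _) = (fun l => - complex.Re (inner ('i%C *: x l) (y l))));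
  last by apply/funext => l; rewrite Im_inner.
apply: measurable_funN; apply: (mRe (fun l => 'i%C *: x l)) => //.
have := di_measP 'i%C mx (di_meas0 X).
by congr di_meas; apply: functional_extensionality_dep => l; rewrite addr0.
Qed.

(** Maximality of the space of measurable sections makes it a module over the
    measurable functions; this covers both truncation and the powers [l^k]. *)
Lemma di_meas_scale (c : R -> R) x :
  measurable_fun half_line c -> di_meas x -> di_meas (fun l => (c l)%:C%C *: x l).
Proof.
move=> mc mx; apply: di_meas_max => y my; have [mr mi] := di_meas_inner mx my.
split.
  rewrite (_ : (fun l => _) = (fun l => c l * complex.Re (inner (x l) (y l)))).
    exact: measurable_funM.
  by apply/funext => l; rewrite innerZl; case: (inner _ _) => a b /=; ring.
rewrite (_ : (fun l => _) = (fun l => c l * complex.Im (inner (x l) (y l)))).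
  exact: measurable_funM.
by apply/funext => l; rewrite innerZl; case: (inner _ _) => a b /=; ring.
Qed.

End Sections.

Section Energy.
Variables (R : realType) (X : direct_integral R).
Implicit Types (x y : section X) (A B : set R) (s c : R).
Local Notation half_line := (`[0, +oo[%classic : set (measurableTypeR R)).
Local Open Scope ereal_scope.

Lemma ae_mono (P Q : R -> Prop) : (forall l, P l -> Q l) ->
  {ae @di_measure R X, forall l, P l} -> {ae @di_measure R X, forall l, Q l}.
Proof. by move=> PQ; apply: negligibleS => l /=; apply: contra_not; exact: PQ. Qed.

Lemma ae_and (P Q : R -> Prop) : {ae @di_measure R X, forall l, P l} ->
  {ae @di_measure R X, forall l, Q l} ->
  {ae @di_measure R X, forall l, P l /\ Q l}.
Proof.
move=> hP hQ; apply: negligibleS (negligibleU hP hQ) => l /= nPQ.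
by apply/not_andP.
Qed.

(** The square of the norm over [A]: unlike the norm, it is additive in [A]. *)
Definition energy A x : \bar R :=
  \int[@di_measure R X]_(l in A) ((hnorm (x l) ^+ 2)%R)%:E.

Lemma energy_ge0 A x : 0 <= energy A x.
Proof. by apply: integral_ge0 => l _; rewrite lee_fin sqr_ge0. Qed.

Lemma sec_norm_onE A x c : (0 <= c)%R ->
  sec_norm_on A x = c%:E <-> energy A x = (c ^+ 2)%:E.
Proof.
move=> c0; rewrite /sec_norm_on -/(energy A x); split => h.
  rewrite -[LHS]poweRe1 ?energy_ge0// -(mulVf (_ : 2 != 0 :> R)%R)//.
  by rewrite poweRrM h poweR_EFin powR_mulrn.
by rewrite h poweR_EFin powR12_sqrt ?sqr_ge0// sqrtr_sqr ger0_norm.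
Qed.

Lemma measurable_energy A x : di_meas x -> A `<=` half_line ->
  measurable (A : set (measurableTypeR R)) ->
  measurable_fun (A : set (measurableTypeR R))
    (fun l => ((hnorm (x l) ^+ 2)%R)%:E).
Proof.
move=> mx sA mA; apply/measurable_EFinP; apply: measurable_funX.
by apply: (measurable_funS _ sA (di_meas_norm mx)); exact: measurable_itv.
Qed.

Lemma energy_ae A x y : di_meas x -> di_meas y -> A `<=` half_line ->
  measurable (A : set (measurableTypeR R)) ->
  {ae @di_measure R X, forall l, A l -> x l = y l} ->
  energy A x = energy A y.
Proof.
move=> mx my sA mA xy; apply: ge0_ae_eq_integral => //.
- exact: measurable_energy.
- exact: measurable_energy.
- by move=> l _; rewrite lee_fin sqr_ge0.
- by move=> l _; rewrite lee_fin sqr_ge0.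
- by apply: ae_mono xy => l h Al; rewrite h.
Qed.

Lemma energyS A B x : di_meas x -> A `<=` B -> B `<=` half_line ->
  measurable (A : set (measurableTypeR R)) ->
  measurable (B : set (measurableTypeR R)) -> energy A x <= energy B x.
Proof.
move=> mx AB sB mA mB; apply: ge0_subset_integral => //.
  exact: measurable_energy.
by move=> l _; rewrite lee_fin sqr_ge0.
Qed.

Lemma energy_le A c x y : di_meas x -> di_meas y -> A `<=` half_line ->
  measurable (A : set (measurableTypeR R)) -> (0 <= c)%R ->
  (forall l, A l -> hnorm (x l) <= c * hnorm (y l))%R ->
  energy A x <= (c ^+ 2)%:E * energy A y.
Proof.
move=> mx my sA mA c0 xy; rewrite /energy -ge0_integralZl_EFin//; last 3 first.
- by move=> l _; rewrite lee_fin sqr_ge0.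
- exact: measurable_energy.
- exact: sqr_ge0.
apply: ge0_le_integral => //.
- by move=> l _; rewrite lee_fin sqr_ge0.
- exact: measurable_energy.
- by apply: measurable_funeM; exact: measurable_energy.
- move=> l Al; rewrite -EFinM lee_fin -exprMn ler_pXn2r ?nnegrE ?hnorm_ge0//.
    exact: xy.
  by rewrite mulr_ge0 ?hnorm_ge0.
Qed.

Lemma energy_setU A B x : di_meas x -> A `|` B `<=` half_line ->
  measurable (A : set (measurableTypeR R)) ->
  measurable (B : set (measurableTypeR R)) -> [disjoint A & B] ->
  energy (A `|` B) x = energy A x + energy B x.
Proof.
move=> mx sAB mA mB dAB; apply: ge0_integral_setU => //.
  by apply: measurable_energy => //; exact: measurableU.
by move=> l _; rewrite lee_fin sqr_ge0.
Qed.

Lemma in_X_energy x : in_X x <-> di_meas x /\ energy half_line x < +oo.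
Proof.
rewrite /in_X /sec_norm /sec_norm_on -/(energy _ x).
split=> -[mx h]; split=> //; last exact: poweR_lty.
by apply: lty_poweRy h; rewrite invr_eq0.
Qed.

End Energy.

(** * Spectral truncation and the K-functional *)

Section Spectral.
Variables (R : realType) (H : hilbertType R) (D : operator H).
Variables (X : direct_integral R) (F : H -> section X).
Hypothesis F_spec : spectral_transform D F.
Implicit Types (f g h : H) (s t : R) (r : nat).
Local Notation half_line := (`[0, +oo[%classic : set (measurableTypeR R)).
Local Notation band s := (`[0, s]%classic : set (measurableTypeR R)).
Local Notation above s := (`]s, +oo[%classic : set (measurableTypeR R)).

Let mF f : di_meas (F f).
Proof. by have [] := st_in F_spec f. Qed.

Let mpow r f : di_meas (mul_pow r (F f)).
Proof.
by apply: (di_meas_scale (c := fun l => l ^+ r)) => //; exact: measurable_funX.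
Qed.

Let band_half s : band s `<=` half_line.
Proof. by move=> l; rewrite /= !in_itv/= => /andP[-> _]. Qed.

Let above_half s : 0 <= s -> above s `<=` half_line.
Proof.
by move=> s0 l; rewrite /= !in_itv/= !andbT => /ltW; exact: le_trans.
Qed.

Let mband s : measurable (band s). Proof. exact: measurable_itv. Qed.
Let mabove s : measurable (above s). Proof. exact: measurable_itv. Qed.
Let mhalf : measurable half_line. Proof. exact: measurable_itv. Qed.

Lemma energy_split s (x : section X) : 0 <= s -> di_meas x ->
  energy half_line x = (energy (band s) x + energy (above s) x)%E.
Proof.
move=> s0 mx; have half_lineE : half_line = band s `|` above s.
  apply/seteqP; split=> l; last by case; [exact: band_half|exact: above_half].
  rewrite /= !in_itv/= !andbT => l0.
  by have [ls|sl] := leP l s; [left|right]; rewrite //= ?l0.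
rewrite [in LHS]half_lineE energy_setU// -?half_lineE//.
rewrite disj_set2E; apply/eqP/seteqP; split=> l //=.
by rewrite !in_itv/= andbT => -[/andP[_ ls]]; rewrite ltNge ls.
Qed.

Lemma energy_transform f : energy half_line (F f) = ((hnorm f) ^+ 2)%:E.
Proof. by apply/sec_norm_onE; [exact: hnorm_ge0|exact: (st_isometry F_spec)]. Qed.

(** The common value of [decay] and [best_approx] at [s], as a real number. *)
Definition tail f s : R := fine (decay F f s).

Lemma energy_tail f s : 0 <= s -> energy (above s) (F f) = (tail f s ^+ 2)%:E.
Proof.
move=> s0; have e0 := energy_ge0 (above s) (F f).
have : (energy (above s) (F f) <= (hnorm f ^+ 2)%:E)%E.
  by rewrite -energy_transform; apply: energyS => //; exact: above_half.
rewrite /tail /decay /sec_norm_on -/(energy _ _).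
case: (energy _ _) e0 => [e| |] //=; rewrite !lee_fin => e0 _.
by rewrite powR12_sqrt// sqr_sqrtr.
Qed.

Lemma tail_ge0 f s : 0 <= tail f s.
Proof. by rewrite /tail fine_ge0// /decay /sec_norm_on poweR_ge0. Qed.

Lemma decayE f s : 0 <= s -> decay F f s = (tail f s)%:E.
Proof. by move=> s0; apply/sec_norm_onE; [exact: tail_ge0|exact: energy_tail]. Qed.

Lemma tail_le_hnorm f s : 0 <= s -> tail f s <= hnorm f.
Proof.
move=> s0; rewrite -(ler_pXn2r (n := 2))// ?nnegrE ?tail_ge0 ?hnorm_ge0//.
rewrite -lee_fin -energy_tail// -energy_transform.
by apply: energyS => //; exact: above_half.
Qed.

Lemma tail_antitone f s t : 0 <= s -> s <= t -> tail f t <= tail f s.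
Proof.
move=> s0 st; rewrite -(ler_pXn2r (n := 2))// ?nnegrE ?tail_ge0//.
rewrite -lee_fin -!energy_tail//; last exact: le_trans st.
apply: energyS => //; last exact: above_half.
by move=> l; rewrite /= !in_itv/= !andbT; exact: le_lt_trans.
Qed.

(** The transforms of [f] and [f - g] agree beyond [s], so the energy of the
    former there is part of the energy of the latter. *)
Lemma paley_wiener_dist f g s : 0 < s -> paley_wiener F s g ->
  tail f s <= hnorm (f - g).
Proof.
move=> s0 gs; have s0' := ltW s0.
rewrite -(ler_pXn2r (n := 2))// ?nnegrE ?tail_ge0 ?hnorm_ge0//.
rewrite -lee_fin -energy_tail// -energy_transform.
rewrite (_ : energy _ (F f) = energy (above s) (F (f - g))).
  by apply: energyS => //; exact: above_half.
apply: energy_ae => //; first exact: above_half.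
have := st_linear F_spec (-1) g f; rewrite scaleN1r addrC => lin.
apply: ae_mono (ae_and lin gs) => l [hl hg]; rewrite /= in_itv/= andbT => sl.
by rewrite hl ?(le_trans s0' (ltW sl))// hg// scaler0 add0r.
Qed.

Lemma spectral_truncation f s : 0 < s -> exists g,
  sec_eq (F g) (fun l => ((l <= s)%R%:R : R)%:C%C *: F f l).
Proof.
move=> s0; apply: (st_surj F_spec); apply/in_X_energy.
have mt : di_meas (fun l => ((l <= s)%R%:R : R)%:C%C *: F f l).
  apply: (di_meas_scale (c := fun l => (l <= s)%R%:R)) => //.
  rewrite (_ : (fun l => _) = \1_(`]-oo, s]%classic : set R)).
    by apply: measurable_indic; exact: measurable_itv.
  by apply/funext => l; rewrite indicE mem_setE in_itv/=.
split=> //; apply: (@le_lt_trans _ _ ((1 ^+ 2)%:E * energy half_line (F f))%E).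
  apply: energy_le => // l _; rewrite hnormZ_real//.
  by rewrite ler_wpM2r ?hnorm_ge0// lern1 leq_b1.
by rewrite energy_transform -EFinM ltry.
Qed.

(** The norm of [D^r P_s f], computed on the spectral side; see
    [spectral_projection]. *)
Definition trunc_pow_norm r f s : R := fine (sec_norm_on (band s) (mul_pow r (F f))).

Lemma hnorm_mul_pow r f l : 0 <= l ->
  hnorm (mul_pow r (F f) l) = l ^+ r * hnorm (F f l).
Proof. by move=> l0; rewrite hnormZ_real// exprn_ge0. Qed.

Lemma energy_trunc_pow r f s : 0 < s ->
  energy (band s) (mul_pow r (F f)) = (trunc_pow_norm r f s ^+ 2)%:E.
Proof.
move=> s0; have e0 := energy_ge0 (band s) (mul_pow r (F f)).
have : (energy (band s) (mul_pow r (F f)) < +oo)%E.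
  apply: (@le_lt_trans _ _ (((s ^+ r) ^+ 2)%:E * energy half_line (F f))%E).
    apply: (@le_trans _ _ (((s ^+ r) ^+ 2)%:E * energy (band s) (F f))%E).
      apply: energy_le => //; first by rewrite exprn_ge0// ltW.
      move=> l; rewrite /= in_itv/= => /andP[l0 ls]; rewrite hnorm_mul_pow//.
      by rewrite ler_wpM2r ?hnorm_ge0// lerXn2r// ?nnegrE// ltW.
    by apply: lee_wpmul2l; [rewrite lee_fin sqr_ge0|apply: energyS].
  by rewrite energy_transform -EFinM ltry.
rewrite /trunc_pow_norm /sec_norm_on -/(energy _ _).
case: (energy _ _) e0 => [e| |] //=; rewrite !lee_fin => e0 _.
by rewrite powR12_sqrt// sqr_sqrtr.
Qed.

Lemma trunc_pow_norm_ge0 r f s : 0 <= trunc_pow_norm r f s.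
Proof. by rewrite /trunc_pow_norm fine_ge0// /sec_norm_on poweR_ge0. Qed.

(** The element [g] is [P_s f], whose transform is that of [f] cut off at [s].
    It lies in the domain of every [D^r] because [l^r <= s^r] where its
    transform lives. *)
Lemma spectral_projection f s : 0 < s -> exists g,
  [/\ paley_wiener F s g, hnorm (f - g) = tail f s, hnorm g <= hnorm f &
      forall r, pow_dom D r g /\ hnorm (iter r D g) = trunc_pow_norm r f s].
Proof.
move=> s0; have s0' := ltW s0.
have [g Fg] := spectral_truncation f s0; exists g.
have Fg_above : {ae @di_measure R X, forall l, s < l -> F g l = 0}.
  apply: ae_mono Fg => l h sl.
  by rewrite h ?(le_trans s0' (ltW sl))// leNgt sl/= scale0r.
have Fg_band : {ae @di_measure R X, forall l, 0 <= l <= s -> F g l = F f l}.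
  by apply: ae_mono Fg => l h /andP[l0 ls]; rewrite h// ls scale1r.
have eq_norm (a b : R) : 0 <= a -> 0 <= b -> (a ^+ 2)%:E = (b ^+ 2)%:E -> a = b.
  by move=> a0 b0 [] /eqP; rewrite eqrXn2// => /eqP.
have above0 (x : section X) : di_meas x ->
    {ae @di_measure R X, forall l, s < l -> x l = 0} -> energy (above s) x = 0%E.
  move=> mx x0; rewrite (energy_ae (y := fun=> 0) mx (di_meas0 X))//.
  - by apply: integral0_eq => l _; rewrite hnorm_zero expr0n.
  - exact: above_half.
  - by apply: ae_mono x0 => l h; rewrite /= in_itv/= andbT; exact: h.
have Dg r : in_X (mul_pow r (F g)) /\
    energy half_line (mul_pow r (F g)) = (trunc_pow_norm r f s ^+ 2)%:E.
  suff e : energy half_line (mul_pow r (F g)) = (trunc_pow_norm r f s ^+ 2)%:E.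
    by split=> //; apply/in_X_energy; split=> //; rewrite e ltry.
  rewrite (energy_split s0')// above0// ?adde0 -?energy_trunc_pow//.
    apply: energy_ae => //; apply: ae_mono Fg_band => l h.
    by rewrite /= in_itv/= /mul_pow => /h ->.
  by apply: ae_mono Fg_above => l h sl; rewrite /mul_pow h// scaler0.
split=> //.
- apply: eq_norm; rewrite ?hnorm_ge0 ?tail_ge0//.
  rewrite -energy_tail// -energy_transform (energy_split s0')//.
  have := st_linear F_spec (-1) g f; rewrite scaleN1r addrC => lin.
  rewrite [X in (X + _)%E](_ : _ = 0%E) ?add0e; last first.
    rewrite (energy_ae (y := fun=> 0) _ (di_meas0 X))//.
      by apply: integral0_eq => l _; rewrite hnorm_zero expr0n.
    apply: ae_mono (ae_and lin Fg_band) => l [hl hg]; rewrite /= in_itv/= => lb.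
    by rewrite hl; [rewrite hg// scaleN1r addNr|case/andP: lb].
  apply: energy_ae => //; first exact: above_half.
  apply: ae_mono (ae_and lin Fg_above) => l [hl hg]; rewrite /= in_itv/= andbT => sl.
  by rewrite hl ?(le_trans s0' (ltW sl))// hg// scaler0 add0r.
- rewrite -(ler_pXn2r (n := 2))// ?nnegrE ?hnorm_ge0// -lee_fin -!energy_transform.
  rewrite [X in (X <= _)%E](energy_split s0')// above0// adde0.
  by rewrite (energy_ae (y := F f))//; exact: energyS.
- move=> r; have [inX e] := Dg r; have dom := (st_dom F_spec r g).2 inX.
  split=> //; apply: eq_norm; rewrite ?hnorm_ge0 ?trunc_pow_norm_ge0//.
  rewrite -e -energy_transform; apply: energy_ae => //.
  apply: ae_mono (st_pow F_spec dom) => l h.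
  by rewrite /= in_itv/= andbT; exact: h.
Qed.

Lemma best_approxE f s : 0 < s -> best_approx F f s = (tail f s)%:E.
Proof.
move=> s0; apply/eqP; rewrite eq_le; apply/andP; split.
  have [g [gs fg _ _]] := spectral_projection f s0.
  by apply: ereal_inf_lbound; exists g => //; rewrite fg.
apply: le_ereal_inf_tmp => _ [g gs <-]; rewrite lee_fin.
exact: paley_wiener_dist.
Qed.

(** Testing the tail of [f + g] against the truncation of [g] reduces this to
    the triangle inequality in [H]. *)
Lemma tailD_le f g s : 0 < s -> tail (f + g) s <= hnorm f + tail g s.
Proof.
move=> s0; have [h [hs <- _ _]] := spectral_projection g s0.
apply: le_trans (paley_wiener_dist (f + g) s0 hs) _.
by rewrite -addrA; exact: hnorm_triangle.
Qed.

(** The Jackson-type half of the argument: [l^r >= s^r] beyond [s]. *)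
Lemma tail_le_pow r f s : 0 < s -> pow_dom D r f ->
  s ^+ r * tail f s <= hnorm (iter r D f).
Proof.
move=> s0 dom; have s0' := ltW s0; have sr0 : 0 <= s ^+ r by exact: exprn_ge0.
have half_ae : {ae @di_measure R X, forall l, half_line l ->
    F (iter r D f) l = mul_pow r (F f) l}.
  apply: ae_mono (st_pow F_spec dom) => l h.
  by rewrite /= in_itv/= andbT; exact: h.
have [->|t0] := eqVneq (tail f s) 0; first by rewrite mulr0 hnorm_ge0.
rewrite -(ler_pXn2r (n := 2))// ?nnegrE ?hnorm_ge0 ?mulr_ge0 ?tail_ge0//.
have srp : 0 < s ^+ r by exact: exprn_gt0.
rewrite exprMn -ler_pdivlMl ?exprn_gt0// -exprVn.
rewrite -lee_fin [X in (_ <= X)%E]EFinM -energy_transform -energy_tail//.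
rewrite (energy_ae _ _ _ _ half_ae)//.
apply: (@le_trans _ _ (((s ^+ r)^-1 ^+ 2)%:E * energy (above s) (mul_pow r (F f)))%E).
  apply: energy_le => //; [exact: above_half|by rewrite invr_ge0|].
  move=> l; rewrite /= in_itv/= andbT => sl.
  have l0 : 0 <= l by apply: le_trans (ltW sl).
  rewrite hnorm_mul_pow// mulrA ler_peMl ?hnorm_ge0// mulrC ler_pdivlMr// mul1r.
  by rewrite lerXn2r ?nnegrE// ltW.
apply: lee_wpmul2l; first by rewrite lee_fin sqr_ge0.
by apply: energyS => //; exact: above_half.
Qed.

(** The Bernstein-type half: the squares add up over the layer [s < l <= t],
    where [l^r <= t^r]. *)
Lemma trunc_pow_norm_step r f s t : 0 < s -> s <= t ->
  trunc_pow_norm r f t <= trunc_pow_norm r f s + t ^+ r * tail f s.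
Proof.
move=> s0 st; have s0' := ltW s0; have t0 : 0 < t by exact: lt_le_trans st.
have tr0 : 0 <= t ^+ r by rewrite exprn_ge0// ltW.
have tt0 : 0 <= t ^+ r * tail f s by rewrite mulr_ge0 ?tail_ge0.
have l0 := trunc_pow_norm_ge0 r f s.
rewrite -(ler_pXn2r (n := 2))// ?nnegrE ?trunc_pow_norm_ge0 ?addr_ge0//.
apply: (@le_trans _ _ (trunc_pow_norm r f s ^+ 2 + (t ^+ r * tail f s) ^+ 2)); last by nra.
rewrite -lee_fin EFinD exprMn [X in (_ <= _ + X)%E]EFinM -!energy_trunc_pow// -energy_tail//.
pose layer : set (measurableTypeR R) := `]s, t]%classic.
have layer_above : layer `<=` above s.
  by move=> l; rewrite /layer/= !in_itv/= andbT => /andP[].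
have layer_half : layer `<=` half_line.
  by apply: subset_trans layer_above _; exact: above_half.
have bandE : band t = band s `|` layer.
  apply/seteqP; split=> l; rewrite /layer/= !in_itv/=.
    by case/andP=> l0' lt; have [ls|sl] := leP l s; [left; rewrite l0'|right].
  case=> /andP[h1 h2]; first by rewrite h1 (le_trans h2).
  by rewrite h2 (le_trans s0' (ltW h1)).
have mlayer : measurable layer by exact: measurable_itv.
rewrite bandE energy_setU// -?bandE//; last first.
  rewrite disj_set2E; apply/eqP/seteqP; split=> l //=.
  by rewrite /layer/= !in_itv/= => -[/andP[_ ls]] /andP[]; rewrite ltNge ls.
apply: leeD2l; apply: (@le_trans _ _ (((t ^+ r) ^+ 2)%:E * energy layer (F f))%E).
  apply: energy_le => // l; rewrite /layer/= in_itv/= => /andP[sl lt].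
  have l0' : 0 <= l by apply: le_trans (ltW sl).
  by rewrite hnorm_mul_pow// ler_wpM2r ?hnorm_ge0// lerXn2r ?nnegrE// ltW.
apply: lee_wpmul2l; first by rewrite lee_fin sqr_ge0.
by apply: energyS => //; exact: above_half.
Qed.

Lemma trunc_pow_norm1_le r f : trunc_pow_norm r f 1 <= hnorm f.
Proof.
rewrite -(ler_pXn2r (n := 2))// ?nnegrE ?trunc_pow_norm_ge0 ?hnorm_ge0//.
rewrite -lee_fin -energy_trunc_pow// -energy_transform.
apply: (@le_trans _ _ (energy (band 1) (F f))); last exact: energyS.
apply: le_trans (energy_le (c := 1) (y := F f) _ _ _ _ _ _) _ => //; last first.
  by rewrite expr1n mul1e.
move=> l; rewrite /= in_itv/= => /andP[l0 l1]; rewrite hnorm_mul_pow//.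
by rewrite ler_wpM2r ?hnorm_ge0// exprn_ile1.
Qed.

Lemma iter_op0 r : iter r D 0 = 0.
Proof.
have D0 : D 0 = 0.
  have := op_linear (-1) (op_dom0 D) (op_dom0 D).
  by rewrite scaler0 addr0 scaleN1r addNr.
by elim: r => //= r ->.
Qed.

Lemma graph_norm_ge0 r f : 0 <= graph_norm D r f.
Proof. by rewrite addr_ge0 ?hnorm_ge0. Qed.

Local Notation K := (K_functional D).

Lemma K_functional_ge0 r f t : 0 <= t -> (0 <= K r f t)%E.
Proof.
move=> t0; apply: le_ereal_inf_tmp => _ [[f0 f1] _ <-] /=.
by rewrite lee_fin addr_ge0 ?hnorm_ge0// mulr_ge0 ?graph_norm_ge0.
Qed.

Lemma K_functional_le_hnorm r f t : (K r f t <= (hnorm f)%:E)%E.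
Proof.
apply: ereal_inf_lbound; exists (f, 0) => /=; last first.
  by rewrite /graph_norm iter_op0 hnorm_zero addr0 mulr0 addr0.
by split; [rewrite addr0|move=> j _; rewrite iter_op0; exact: op_dom0].
Qed.

Lemma K_functional_mono r f s t : s <= t -> (K r f s <= K r f t)%E.
Proof.
move=> st; apply: le_ereal_inf_tmp => _ [[f0 f1] h <-].
apply: le_trans (ereal_inf_lbound _) _; first by exists (f0, f1); [exact: h|].
by rewrite lee_fin lerD2l ler_wpM2r// graph_norm_ge0.
Qed.

Lemma hnorm_le_K r f : ((hnorm f)%:E <= K r f 1)%E.
Proof.
apply: le_ereal_inf_tmp => _ [[f0 f1] [/= -> _] <-] /=.
rewrite lee_fin mul1r; apply: le_trans (hnorm_triangle _ _) _.
by rewrite lerD2l lerDl hnorm_ge0.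
Qed.

(** With [s^(-r)] as parameter, the weight of [|D^r f1|] in the K-functional is
    exactly the one produced by [tail_le_pow]. *)
Lemma tail_le_K r f s : 0 < s -> ((tail f s)%:E <= K r f (s ^- r))%E.
Proof.
move=> s0; apply: le_ereal_inf_tmp => _ [[f0 f1] [/= -> dom] <-] /=.
rewrite lee_fin; apply: le_trans (tailD_le _ _ s0) _; rewrite lerD2l.
rewrite ler_pdivlMl ?exprn_gt0//; apply: le_trans (tail_le_pow s0 dom) _.
by rewrite lerDr hnorm_ge0.
Qed.

Lemma K_le_tail r f s : 0 < s ->
  (K r f (s ^- r) <= (tail f s + s ^- r * (hnorm f + trunc_pow_norm r f s))%:E)%E.
Proof.
move=> s0; have [g [_ fg gf /(_ r) [dom Dg]]] := spectral_projection f s0.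
apply: le_trans (ereal_inf_lbound _) _.
  by exists (f - g, g) => //=; split; rewrite ?subrK.
rewrite /= fg /graph_norm Dg lee_fin lerD2l ler_wpM2l ?lerD2r//.
by rewrite invr_ge0 exprn_ge0// ltW.
Qed.

End Spectral.

(** * Equivalence of the norms *)

Section Auxiliary.
Variable R : realType.

Lemma powR_exprn (b x : R) n : 0 <= b -> (b ^+ n) `^ x = (b `^ x) ^+ n.
Proof. by move=> b0; rewrite -powR_mulrn// powRAC powR_mulrn// powR_ge0. Qed.

Lemma powR_exprVn (b x : R) n : 0 <= b -> (b ^- n) `^ x = (b `^ x) ^- n.
Proof. by move=> b0; rewrite -powR_invn// powRAC powR_invn// powR_ge0. Qed.

Lemma trivIset_itv (c d : nat -> R) :
  (forall i j, (i < j)%N -> d i <= c j \/ d j <= c i) ->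
  trivIset setT (fun k => `[c k, d k[%classic : set R).
Proof.
move=> h.
have disj i j s : (i < j)%N -> c i <= s < d i -> c j <= s < d j -> False.
  move=> ij /andP[h1 h2] /andP[h3 h4]; case: (h i j ij) => h5.
    by move: (lt_le_trans h2 (le_trans h5 h3)); rewrite ltxx.
  by move: (lt_le_trans h4 (le_trans h5 h1)); rewrite ltxx.
move=> i j _ _ [s [/=]]; rewrite !in_itv/= => si sj.
by case: (ltngtP i j) => // ij; [case: (disj i j s)|case: (disj j i s)].
Qed.

Lemma eq_Lq_star (q : \bar R) (u v : R -> \bar R) :
  (forall s, 0 < s -> u s = v s) -> Lq_star q u = Lq_star q v.
Proof.
move=> uv; have uv' s : s \in (`]0, +oo[%classic : set R) -> u s = v s.
  by rewrite inE/= in_itv/= andbT; exact: uv.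
case: q => [p| |] //=.
  by congr poweR; apply: eq_integral => s /uv' ->.
congr ereal_sup; apply/seteqP; split=> _ [s s0 <-]; exists s => //;
  by rewrite uv'// inE.
Qed.

End Auxiliary.

Section Equivalence.
Variables (R : realType) (H : hilbertType R).
Implicit Types N : H -> \bar R.
Local Open Scope ereal_scope.

Definition dominated N1 N2 :=
  exists2 c : R, (0 < c)%R & forall f, N1 f <= c%:E * N2 f.

Lemma dominated_trans N1 N2 N3 :
  dominated N1 N2 -> dominated N2 N3 -> dominated N1 N3.
Proof.
move=> [c c0 h1] [e e0 h2]; exists (c * e)%R => [|f]; first exact: mulr_gt0.
apply: le_trans (h1 f) _; rewrite EFinM -muleA.
by apply: lee_wpmul2l; [rewrite lee_fin ltW|exact: h2].
Qed.

Lemma dominated_equivalent N1 N2 :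
  dominated N1 N2 -> dominated N2 N1 -> equivalent_norms N1 N2.
Proof. by move=> [c c0 h1] [e e0 h2]; exists c, e; split=> // f. Qed.

End Equivalence.

Section Besov.
Variables (R : realType) (H : hilbertType R) (D : operator H).
Variables (X : direct_integral R) (F : H -> section X).
Hypothesis F_spec : spectral_transform D F.
Variables (alpha a : R) (q : \bar R) (r : nat).
Hypotheses (alpha_gt0 : 0 < alpha) (q_gt0 : (0 < q)%E) (a_gt1 : 1 < a).
Hypothesis r_gt : alpha < r%:R.

(** [A] and [B] are the ratios of the weights [s^alpha] and [s^r] between
    consecutive samples [a^k]. Since [B^(alpha/r) = A], the sample points
    [t = B^(-k)] give [t^(-alpha/r)] the value [A^k]. *)
Let A : R := a `^ alpha.
Let B : R := a ^+ r.
Let v f k : R := A ^+ k * tail F f (a ^+ k).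

Let a0 : 0 < a. Proof. exact: lt_trans a_gt1. Qed.
Let a0' : 0 <= a. Proof. exact: ltW. Qed.
Let ak0 k : 0 < a ^+ k. Proof. exact: exprn_gt0. Qed.
Let r0 : 0 < r%:R :> R. Proof. exact: lt_trans r_gt. Qed.
Let B0 : 0 < B. Proof. exact: exprn_gt0. Qed.
Let A0 : 0 < A. Proof. exact: powR_gt0. Qed.

Let A1 : 1 < A.
Proof.
have : 1 `^ alpha < a `^ alpha by apply: gt0_ltr_powR; rewrite ?nnegrE.
by rewrite powR1.
Qed.

Let AB : A < B.
Proof.
by rewrite /B -powR_mulrn// /A /powR gt_eqF// ltr_expR ltr_pM2r// ln_gt0.
Qed.

Let B1 : 1 < B. Proof. exact: lt_trans AB. Qed.

Let Btheta : B `^ (alpha / r%:R) = A.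
Proof. by rewrite /B -powR_mulrn// -powRrM mulrC divfK// gt_eqF. Qed.

Let v0 f k : 0 <= v f k.
Proof. by rewrite mulr_ge0 ?tail_ge0// exprn_ge0// ltW. Qed.

(** The discrete quantity with which all five norms are compared. *)
Let N (f : H) : \bar R := ((hnorm f)%:E + lq_seq q (fun k => (v f k)%:E))%E.

Let lqv_ge0 f : (0 <= lq_seq q (fun k => (v f k)%:E))%E.
Proof. by apply: lq_seq_ge0 => // k; rewrite lee_fin. Qed.

Let N_ge0 f : (0 <= N f)%E.
Proof. by rewrite adde_ge0// lee_fin hnorm_ge0. Qed.

Lemma decay_norm_sumE f : decay_norm_sum F alpha q a f = N f.
Proof.
rewrite /decay_norm_sum /N; congr (_ + lq_seq q _)%E; apply/funext => k.
rewrite (decayE F_spec) ?ltW// -EFinM; congr (_ * _)%:E.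
by rewrite mulrC powRrM powR_mulrn// powR_ge0.
Qed.

Lemma approx_norm_sumE f : approx_norm_sum F alpha q a f = N f.
Proof.
rewrite -decay_norm_sumE /approx_norm_sum /decay_norm_sum.
congr (_ + lq_seq q _)%E; apply/funext => k.
by rewrite (best_approxE F_spec)// (decayE F_spec)// ltW.
Qed.

Lemma approx_norm_intE f : approx_norm_int F alpha q f = decay_norm_int F alpha q f.
Proof.
rewrite /approx_norm_int /decay_norm_int; congr (_ + _)%E.
apply: eq_Lq_star => s s0.
by rewrite (best_approxE F_spec)// (decayE F_spec)// ltW.
Qed.

(** Over [a^k <= s <= a^(k+1)] monotonicity replaces the tail by its value at
    [a^k]; over [a^(-k-1) <= s <= a^(-k)] the tail is at most [|f|], and the
    weights [A^(-k)] form a geometric sequence. *)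
Lemma decay_int_dominated : dominated (decay_norm_int F alpha q) N.
Proof.
have Ainv : 0 <= A^-1 < 1 by rewrite invr_ge0 ltW// invf_lt1.
have [C1 C10 H1] := Lq_star_le_lq q_gt0 a_gt1.
have [C2 C20 H2] := lq_seq_recursion q_gt0 Ainv.
exists (1 + C1 * (A + C2)) => [|f].
  by rewrite ltr_pwDl// mulr_ge0 ?addr_ge0// ltW.
pose W k := A * v f k; pose W' k := A ^- k * hnorm f.
have W'0 k : 0 <= W' k by rewrite mulr_ge0 ?hnorm_ge0// invr_ge0 exprn_ge0// ltW.
have W0 k : 0 <= W k by rewrite mulr_ge0// ltW.
have main := H1 (fun s => (s `^ alpha)%:E * decay F f s)%E W W' _ W0 W'0.
have hW : (lq_seq q (fun k => (W k)%:E) <= A%:E * N f)%E.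
  apply: le_trans (lq_seqZ_le q_gt0 (ltW A0) _) _; first by move=> k.
  by apply: lee_wpmul2l; rewrite ?lee_fin ?(ltW A0)// leeDr// lee_fin hnorm_ge0.
(* The geometric sequence satisfies the recursion with [v] as slack. *)
have hW' : (lq_seq q (fun k => (W' k)%:E) <= C2%:E * N f)%E.
  have -> : N f = ((W' 0%N)%:E + lq_seq q (fun k => (v f k)%:E))%E.
    by rewrite /W' expr0 invr1 mul1r.
  apply: H2 => // k; rewrite /W' exprS invfM -mulrA ler_wpDr//.
rewrite /decay_norm_int EFinD ge0_muleDl//; last first.
  by rewrite lee_fin mulr_ge0 ?addr_ge0// ltW.
rewrite mul1e; apply: leeD; first by rewrite leeDl.
apply: le_trans (main _ _ _) _.
- by move=> s s0; rewrite (decayE F_spec) ?(ltW s0)// -EFinM lee_fin mulr_ge0 ?powR_ge0 ?tail_ge0.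
- move=> k s /andP[h1 h2]; have s0 : 0 < s by exact: lt_le_trans h1.
  rewrite (decayE F_spec) ?(ltW s0)// -EFinM lee_fin /W /v mulrA -exprS.
  apply: ler_pM; rewrite ?powR_ge0 ?tail_ge0//.
    rewrite -powR_exprn//; apply: ge0_ler_powR; rewrite ?nnegrE ?(ltW s0) ?(ltW alpha_gt0)//.
    by rewrite exprn_ge0.
  by apply: (tail_antitone F_spec _ _ h1); rewrite ltW.
- move=> k s /andP[h1 h2]; have s0 : 0 < s by apply: lt_le_trans h1; rewrite invr_gt0.
  rewrite (decayE F_spec) ?(ltW s0)// -EFinM lee_fin /W'.
  apply: ler_pM; rewrite ?powR_ge0 ?tail_ge0//.
    rewrite -powR_exprVn//; apply: ge0_ler_powR; rewrite ?nnegrE ?(ltW s0) ?(ltW alpha_gt0)//.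
    by rewrite invr_ge0 exprn_ge0.
  by apply: (tail_le_hnorm F_spec); rewrite ltW.
rewrite EFinM -muleA; apply: lee_wpmul2l; first by rewrite lee_fin ltW.
by rewrite EFinD ge0_muleDl ?lee_fin ?(ltW A0) ?(ltW C20)//; exact: leeD.
Qed.

(** The samples are compared with the integrand on [a^(k-1) <= s < a^k], to the
    left of [a^k], where the tail is larger; hence the factor [A^(-1)]. *)
Lemma dominated_decay_int : dominated N (decay_norm_int F alpha q).
Proof.
have [C C0 HC] := lq_le_Lq_star q_gt0 a_gt1.
exists (1 + A * C) => [|f]; first by rewrite ltr_pwDl// mulr_ge0// ltW.
pose u s := ((s `^ alpha)%:E * decay F f s)%E.
have u0 s : 0 < s -> (0 <= u s)%E.
  by move=> s0; rewrite /u (decayE F_spec) ?(ltW s0)// -EFinM lee_fin mulr_ge0 ?powR_ge0 ?tail_ge0.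
have L0 : (0 <= Lq_star q u)%E by exact: Lq_star_ge0.
have ACge0 : 0 <= A * C by rewrite mulr_ge0// ltW.
rewrite /decay_norm_int -/u EFinD ge0_muleDl ?lee_fin// mul1e.
apply: leeD; first by rewrite leeDl.
apply: (@le_trans _ _ ((A * C)%:E * Lq_star q u)%E); last first.
  by apply: lee_wpmul2l; rewrite ?lee_fin// leeDr// lee_fin hnorm_ge0.
pose w k := A^-1 * v f k.
have w0 k : 0 <= w k by rewrite mulr_ge0// invr_ge0 ltW.
have -> : (fun k => (v f k)%:E) = (fun k => (A * w k)%:E).
  by apply/funext => k; rewrite /w mulrA divff ?gt_eqF// mul1r.
apply: le_trans (lq_seqZ_le q_gt0 (ltW A0) _) _; first by move=> k.
rewrite EFinM -muleA; apply: lee_wpmul2l; first by rewrite lee_fin ltW.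
apply: (HC u w (fun k => a ^+ k / a)) => //.
- by move=> k; rewrite divr_gt0.
- apply: trivIset_itv => i j ij; left.
  rewrite mulrC divfK ?gt_eqF// ler_pdivlMr// -exprSr.
  by rewrite ler_weXn2l// ltW.
- move=> k s /andP[h1]; rewrite mulrC divfK ?gt_eqF// => h2.
  have s0 : 0 < s by apply: lt_le_trans h1; rewrite divr_gt0.
  rewrite /u (decayE F_spec) ?(ltW s0)// -EFinM lee_fin /w /v mulrA.
  apply: ler_pM; rewrite ?tail_ge0//.
  + by rewrite mulr_ge0 ?exprn_ge0 ?invr_ge0// ltW.
  + rewrite (_ : A^-1 * A ^+ k = (a ^+ k / a) `^ alpha); last first.
      by rewrite powRM ?exprn_ge0 ?invr_ge0// powR_exprn// (powR_exprVn alpha 1 a0') mulrC.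
    by apply: ge0_ler_powR; rewrite ?nnegrE ?(ltW s0) ?(ltW alpha_gt0)// mulr_ge0 ?exprn_ge0 ?invr_ge0.
  + by apply: (tail_antitone F_spec); rewrite ?(ltW s0) ?(ltW h2).
Qed.

Let K f t : R := fine (K_functional D r f t).

Let K_functionalE f t : 0 <= t -> K_functional D r f t = (K f t)%:E.
Proof.
move=> t0; rewrite fineK// fin_numE; apply/andP; split.
  by rewrite gt_eqF// (lt_le_trans _ (K_functional_ge0 D r f t0)) ?ltNy0.
by rewrite lt_eqF// (le_lt_trans (K_functional_le_hnorm _ _ _ _))// ltry.
Qed.

Let K_ge0 f t : 0 <= t -> 0 <= K f t.
Proof. by move=> t0; rewrite -lee_fin -K_functionalE// K_functional_ge0. Qed.

Let Bexp k : B ^+ k = a ^+ k ^+ r.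
Proof. by rewrite /B -!exprM mulnC. Qed.

Let theta := alpha / r%:R.
Let theta_ge0 : 0 <= theta. Proof. by rewrite divr_ge0// ltW. Qed.

Let weight_le b t : 0 < b -> b <= t -> t `^ (- theta) <= (b `^ theta)^-1.
Proof.
move=> b0 bt; have t0 := lt_le_trans b0 bt.
rewrite powRN lef_pV2 ?posrE ?powR_gt0//.
by apply: ge0_ler_powR; rewrite ?nnegrE ?(ltW b0) ?(ltW t0).
Qed.

(** For [t >= 1] the bound [K(f, t) <= |f|] leaves a geometric sequence [W].
    For [B^(-k-1) <= t <= B^(-k)], [K_le_tail] at [s = a^k] gives the bound
    [W' k], whose part [z] obeys the Hardy recursion of ratio [A / B]. *)
Lemma besov_dominated : dominated (besov_norm D r alpha q) N.
Proof.
have Ainv : 0 <= A^-1 < 1 by rewrite invr_ge0 ltW// invf_lt1.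
have rho01 : 0 <= A / B < 1.
  by rewrite divr_ge0 ?(ltW A0) ?(ltW B0)//= ltr_pdivrMr// mul1r.
have [C1 C10 H1] := Lq_star_le_lq q_gt0 B1.
have [C2 C20 H2] := lq_seq_recursion q_gt0 Ainv.
have [C3 C30 H3] := lq_seq_recursion q_gt0 rho01.
have [C4 C40 H4] := lq_seqD_le q_gt0.
exists (C1 * (C2 + A * (C4 * (1 + C3 * (2 + A))))) => [|f].
  by rewrite !(mulr_gt0, addr_gt0).
pose z k := (A / B) ^+ k * (hnorm f + trunc_pow_norm F r f (a ^+ k)).
pose W k := A ^- k * hnorm f; pose W' k := A * (v f k + z k).
have z0 k : 0 <= z k.
  rewrite mulr_ge0 ?addr_ge0 ?hnorm_ge0 ?trunc_pow_norm_ge0// exprn_ge0//.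
  by case/andP: rho01.
have W0 k : 0 <= W k by rewrite mulr_ge0 ?hnorm_ge0// invr_ge0 exprn_ge0// ltW.
have W'0 k : 0 <= W' k by rewrite mulr_ge0 ?addr_ge0// ltW.
(* The geometric sequence satisfies the recursion with [v] as slack. *)
have hW : (lq_seq q (fun k => (W k)%:E) <= C2%:E * N f)%E.
  have -> : N f = ((W 0%N)%:E + lq_seq q (fun k => (v f k)%:E))%E.
    by rewrite /W expr0 invr1 mul1r.
  by apply: H2 => // k; rewrite /W exprS invfM -mulrA ler_wpDr.
have hz : (lq_seq q (fun k => (z k)%:E) <= (C3 * (2 + A))%:E * N f)%E.
  apply: (@le_trans _ _ (C3%:E * ((z 0%N)%:E + lq_seq q (fun k => (A * v f k)%:E)))%E).
    apply: H3 => // k; first by rewrite mulr_ge0// ltW.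
    have := trunc_pow_norm_step F_spec r f (ak0 k) (ler_weXn2l (ltW a_gt1) (leqnSn k)).
    rewrite -Bexp => step.
    apply: (@le_trans _ _ ((A / B) ^+ k.+1 * (hnorm f +
        (trunc_pow_norm F r f (a ^+ k) + B ^+ k.+1 * tail F f (a ^+ k))))).
      by rewrite /z ler_wpM2l ?lerD2l// exprn_ge0//; case/andP: rho01.
    rewrite addrA mulrDr /z [X in _ <= X + _]mulrA -exprS lerD2l mulrA expr_div_n divfK ?expf_neq0 ?gt_eqF//.
    by rewrite exprS -mulrA.
  rewrite (EFinM C3) -muleA; apply: lee_wpmul2l; first by rewrite lee_fin ltW.
  rewrite EFinD ge0_muleDl ?lee_fin// ?(ltW A0)//; apply: leeD.
    apply: (@le_trans _ _ (2%:E * (hnorm f)%:E)%E).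
      rewrite -EFinM lee_fin /z expr0 mul1r expr0.
      by have := trunc_pow_norm1_le F_spec r f; lra.
    by apply: lee_wpmul2l; rewrite ?leeDl// lee_fin.
  apply: le_trans (lq_seqZ_le q_gt0 (ltW A0) _) _; first by move=> k.
  by apply: lee_wpmul2l; rewrite ?lee_fin ?(ltW A0)// leeDr// lee_fin hnorm_ge0.
have hW' : (lq_seq q (fun k => (W' k)%:E) <= (A * (C4 * (1 + C3 * (2 + A))))%:E * N f)%E.
  apply: (@le_trans _ _ (A%:E * lq_seq q (fun k => (v f k + z k)%:E))%E).
    by apply: (lq_seqZ_le q_gt0 (ltW A0)) => k; rewrite addr_ge0.
  rewrite (EFinM A) -muleA; apply: lee_wpmul2l; first by rewrite lee_fin ltW.
  apply: le_trans (H4 _ _ _ _) _; try by move=> k.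
  rewrite (EFinM C4) -muleA; apply: lee_wpmul2l; first by rewrite lee_fin ltW.
  rewrite EFinD ge0_muleDl ?lee_fin//; last by rewrite mulr_ge0 ?addr_ge0// ltW.
  by rewrite mul1e; apply: leeD => //; rewrite leeDr// lee_fin hnorm_ge0.
rewrite (EFinM C1) -muleA EFinD ge0_muleDl ?lee_fin ?(ltW C20)//; last first.
  by rewrite !(mulr_ge0, addr_ge0)// ltW.
apply: le_trans (H1 _ W W' _ _ _ _ _) _ => //.
- by move=> t t0; rewrite K_functionalE ?(ltW t0)// -EFinM lee_fin mulr_ge0 ?powR_ge0 ?K_ge0 ?ltW.
- move=> k t /andP[h1 _]; have Bk : 0 < B ^+ k by exact: exprn_gt0.
  have t0 := lt_le_trans Bk h1.
  rewrite K_functionalE ?(ltW t0)// -EFinM lee_fin /W.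
  apply: ler_pM; rewrite ?powR_ge0 ?K_ge0 ?(ltW t0)//.
    by rewrite -Btheta -powR_exprn ?(ltW B0)//; exact: weight_le.
  by rewrite -lee_fin -K_functionalE ?(ltW t0)//; exact: K_functional_le_hnorm.
- move=> k t /andP[h1 h2]; have Bk : 0 < B ^- k.+1 by rewrite invr_gt0 exprn_gt0.
  have t0 := lt_le_trans Bk h1.
  have -> : W' k = A ^+ k.+1 * (tail F f (a ^+ k) + B ^- k * (hnorm f + trunc_pow_norm F r f (a ^+ k))).
    by rewrite /W' /v /z exprMn exprVn exprS; ring.
  rewrite K_functionalE ?(ltW t0)// -EFinM lee_fin.
  apply: ler_pM; rewrite ?powR_ge0 ?K_ge0 ?(ltW t0)//.
    rewrite -[A ^+ k.+1]invrK -Btheta -powR_exprVn ?(ltW B0)//.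
    exact: weight_le.
  rewrite -lee_fin -K_functionalE ?(ltW t0)//.
  apply: le_trans (K_functional_mono _ _ _ h2) _.
  by rewrite Bexp; apply: K_le_tail.
- by apply: lee_wpmul2l; [rewrite lee_fin ltW|exact: leeD].
Qed.

(** The K-functional is nondecreasing, so its value at [B^(-k)] is compared with
    the integrand on [B^(-k) <= t < B^(1-k)]. *)
Lemma dominated_besov : dominated N (besov_norm D r alpha q).
Proof.
have [C C0 HC] := lq_le_Lq_star q_gt0 B1.
exists (2 * A * C) => [|f]; first by rewrite !mulr_gt0.
have BV0 k : 0 < B ^- k by rewrite invr_gt0 exprn_gt0.
pose w k := A^-1 * (A ^+ k * K f (B ^- k)).
have w0 k : 0 <= w k.
  by rewrite !mulr_ge0 ?invr_ge0 ?exprn_ge0 ?K_ge0 ?(ltW A0) ?(ltW (BV0 k)).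
have lqw : (lq_seq q (fun k => (w k)%:E) <= C%:E * besov_norm D r alpha q f)%E.
  apply: (HC _ w (fun k => B ^- k)) => //.
  - by move=> t t0; rewrite K_functionalE ?(ltW t0)// -EFinM lee_fin mulr_ge0 ?powR_ge0 ?K_ge0 ?ltW.
  - apply: trivIset_itv => i j ij; right.
    rewrite ler_pdivrMr ?exprn_gt0// mulrC ler_pdivlMr ?exprn_gt0//.
    by rewrite -exprS ler_weXn2l// ltW.
  - move=> k t /andP[h1 h2]; have t0 := lt_le_trans (BV0 k) h1.
    rewrite K_functionalE ?(ltW t0)// -EFinM lee_fin /w mulrA.
    apply: ler_pM; rewrite ?K_ge0 ?(ltW (BV0 k))//.
    + by rewrite mulr_ge0 ?invr_ge0 ?exprn_ge0 ?(ltW A0).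
    + rewrite powRN (_ : A^-1 * A ^+ k = (A * A ^- k)^-1); last by rewrite invfM invrK.
      rewrite lef_pV2 ?posrE ?powR_gt0 ?mulr_gt0 ?invr_gt0 ?exprn_gt0//.
      rewrite (_ : A * A ^- k = (B * B ^- k) `^ theta); last first.
        by rewrite powRM ?(ltW B0) ?(ltW (BV0 k))// powR_exprVn ?(ltW B0)// Btheta.
      by apply: ge0_ler_powR; rewrite ?nnegrE ?(ltW t0) ?(ltW h2)// mulr_ge0 ?(ltW B0) ?(ltW (BV0 k)).
    + by rewrite -lee_fin -!K_functionalE ?(ltW t0) ?(ltW (BV0 k))//; exact: K_functional_mono.
have Aw k : A * w k = A ^+ k * K f (B ^- k) by rewrite /w mulrA divff ?gt_eqF// mul1r.
have hv : (lq_seq q (fun k => (v f k)%:E) <= A%:E * lq_seq q (fun k => (w k)%:E))%E.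
  apply: le_trans (lq_seqZ_le q_gt0 (ltW A0) w0).
  apply: le_lq_seq => // k; first by rewrite lee_fin.
  rewrite lee_fin Aw /v ler_wpM2l ?exprn_ge0 ?(ltW A0)//.
  by rewrite -lee_fin -K_functionalE ?(ltW (BV0 k))// Bexp; exact: tail_le_K.
have hf : ((hnorm f)%:E <= A%:E * lq_seq q (fun k => (w k)%:E))%E.
  apply: (@le_trans _ _ (A%:E * (w 0%N)%:E)%E).
    by rewrite -EFinM Aw expr0 invr1 mul1r -K_functionalE//; exact: hnorm_le_K.
  apply: lee_wpmul2l; first by rewrite lee_fin ltW.
  by apply: (@lq_seq_ge_term _ _ (fun k => (w k)%:E) 0%N) => // k; rewrite lee_fin.
apply: le_trans (leeD hf hv) _.
have lw0 : (0 <= lq_seq q (fun k => (w k)%:E))%E.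
  by apply: lq_seq_ge0 => // k; rewrite lee_fin.
rewrite -ge0_muleDl ?lee_fin ?(ltW A0)// -EFinD (_ : A + A = 2 * A); last by ring.
rewrite (EFinM (2 * A)) -muleA; apply: lee_wpmul2l => //.
by rewrite lee_fin mulr_ge0// ltW.
Qed.

End Besov.

Theorem theorem1p1 (R : realType) (H : hilbertType R) (L D : operator H)
    (L_sa : self_adjoint L) (L_pos : positive_definite L)
    (D_sqrt : positive_sqrt L D)
    (X : direct_integral R) (F : H -> section X)
    (F_spec : spectral_transform D F)
    (alpha : R) (alpha_gt0 : 0 < alpha)
    (q : \bar R) (q_ge1 : (1 <= q)%E)
    (a : R) (a_gt1 : 1 < a)
    (r : nat) (r_gt : alpha < r%:R) :
  [/\ equivalent_norms (besov_norm D r alpha q) (approx_norm_int F alpha q),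
      equivalent_norms (besov_norm D r alpha q) (approx_norm_sum F alpha q a),
      equivalent_norms (besov_norm D r alpha q) (decay_norm_int F alpha q) &
      equivalent_norms (besov_norm D r alpha q) (decay_norm_sum F alpha q a)].
Proof.
have q_gt0 : (0 < q)%E by exact: lt_le_trans q_ge1.
have -> : approx_norm_int F alpha q = decay_norm_int F alpha q.
  by apply/funext => f; exact: (approx_norm_intE F_spec).
have -> : approx_norm_sum F alpha q a = decay_norm_sum F alpha q a.
  by apply/funext => f; rewrite (decay_norm_sumE F_spec)// (approx_norm_sumE F_spec).
have e := funext (decay_norm_sumE F_spec alpha q a_gt1).
have int_sum := decay_int_dominated F_spec alpha_gt0 q_gt0 a_gt1.
have sum_int := dominated_decay_int F_spec alpha_gt0 q_gt0 a_gt1.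
have besov_sum := besov_dominated F_spec alpha_gt0 q_gt0 a_gt1 r_gt.
have sum_besov := dominated_besov F_spec alpha_gt0 q_gt0 a_gt1 r_gt.
rewrite -e in int_sum sum_int besov_sum sum_besov.
have h1 : equivalent_norms (besov_norm D r alpha q) (decay_norm_sum F alpha q a).
  exact: dominated_equivalent.
have h2 : equivalent_norms (besov_norm D r alpha q) (decay_norm_int F alpha q).
  by apply: dominated_equivalent; [exact: dominated_trans sum_int|exact: dominated_trans sum_besov].
by split.
Qed.
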